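(* If $C$ is a symmetric cone, then the pair $(C_\square,C)$ has the Lorentz factorization property (LFP).
   Context: All vector spaces are real and finite-dimensional. A convex cone $C\subseteq V$ is proper if it is closed, pointed ($C\cap(-C)=\{0\}$) and generating (it spans $V$). The square-based cone is $C_\square=\{(x,y,z)\in\mathbb{R}^3 : |y|+|z|\le x\}$. A proper cone $C\subseteq V$ is symmetric if it is selfdual (there is an inner product on $V$ with $C=\{y\in V : \langle x,y\rangle\ge 0 \text{ for all } x\in C\}$) and its automorphism group (linear bijections of $V$ mapping $C$ onto $C$) acts transitively on the interior of $C$. By Vinberg's classification theorem, a proper cone is symmetric if and only if it is (isomorphic to) a direct sum of cones from the following families: Lorentz cones $L_n$; the cones $\mathrm{PSD}_n(\mathbb{R}),\mathrm{PSD}_n(\mathbb{C}),\mathrm{PSD}_n(\mathbb{H})$ of positive semidefinite $n\times n$ matrices over the reals, complex numbers and quaternions; the cone $\mathrm{PSD}_3(\mathbb{O})$ of positive semidefinite $3\times 3$ matrices over the octonions. Here, for $n\ge 1$, the Lorentz cone is $L_n=\{(t,x_1,\dots,x_{n-1})\in\mathbb{R}^n : t\ge (x_1^2+\cdots+x_{n-1}^2)^{1/2}\}$; a cone is Lorentzian if it is linearly isomorphic to some $L_n$. For proper cones $C_1\subseteq V_1$, $C_2\subseteq V_2$, $\mathrm{Pos}(C_1,C_2)$ is the set of linear maps $P:V_1\to V_2$ with $P(C_1)\subseteq C_2$, and $\mathrm{LorFact}(C_1,C_2)=\operatorname{conv}\{\beta\alpha : \alpha\in\mathrm{Pos}(C_1,L),\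 \beta\in\mathrm{Pos}(L,C_2),\ L \text{ a Lorentzian cone}\}$. The pair $(C_1,C_2)$ has the Lorentz factorization property (LFP) if $\mathrm{LorFact}(C_1,C_2)=\mathrm{Pos}(C_1,C_2)$. *)

(* Defs.v *)
From HB Require Import structures.
From mathcomp Require Import all_boot all_order all_algebra.
From mathcomp Require Import boolp classical_sets reals topology normedtype.

Set Implicit Arguments.
Unset Strict Implicit.
Unset Printing Implicit Defensive.

Import Order.TTheory GRing.Theory Num.Theory.
Import numFieldNormedType.Exports.

Local Open Scope classical_set_scope.
Local Open Scope ring_scope.

(* A [vectType] carries no topology. Its canonical topology is transported from
   ['rV[R]_(dim V)] along the linear isomorphism [v2r]; every linear isomorphism
   with a coordinate space induces the same one. *)
Definition vclosed (R : realType) (V : vectType R) (A : set V) : Prop :=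
  closed (VectorInternalTheory.v2r @` A).

Definition vinterior (R : realType) (V : vectType R) (A : set V) : set V :=
  VectorInternalTheory.v2r @^-1` (interior (VectorInternalTheory.v2r @` A)).

Definition convex_cone (R : realType) (V : vectType R) (C : set V) : Prop :=
  [/\ C 0,
      forall x y, C x -> C y -> C (x + y) &
      forall (a : R) x, 0 <= a -> C x -> C (a *: x)].

Definition pointed_cone (R : realType) (V : vectType R) (C : set V) : Prop :=
  C `&` [set - x | x in C] = [set 0].

Definition generating (R : realType) (V : vectType R) (C : set V) : Prop :=
  exists2 X : seq V, {in X, forall x, C x} & <<X>>%VS = fullv.

Definition proper_cone (R : realType) (V : vectType R) (C : set V) : Prop :=
  [/\ convex_cone C, vclosed C, pointed_cone C & generating C].

Definition cone_iso (R : realType) (V W : vectType R) (C : set V) (D : set W)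
    (f : 'Hom(V, W)) : Prop :=
  bijective f /\ f @` C = D.

(* [{dot V for idfun}] is the type of inner products on [V]: symmetric, positive
   definite bilinear forms. *)
Definition selfdual (R : realType) (V : vectType R) (C : set V) : Prop :=
  exists ip : {dot V for @idfun R},
    C = [set y : V | forall x : V, C x -> 0 <= ip x y].

Definition homogeneous (R : realType) (V : vectType R) (C : set V) : Prop :=
  forall x y, vinterior C x -> vinterior C y ->
    exists2 f : 'End(V), cone_iso C C f & f x = y.

Definition symmetric_cone (R : realType) (V : vectType R) (C : set V) : Prop :=
  [/\ proper_cone C, selfdual C & homogeneous C].

Definition square_cone (R : realType) : set 'rV[R]_3 :=
  [set v : 'rV[R]_3 | `|v 0 1| + `|v 0 2| <= v 0 0].

(* [lorentz_cone R n] lives in dimension [n.+1]; the coordinate of index 0 plays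
   the role of the time coordinate. *)
Definition lorentz_cone (R : realType) (n : nat) : set 'rV[R]_n.+1 :=
  [set v : 'rV[R]_n.+1 | Num.sqrt (\sum_(i < n) v 0 (lift ord0 i) ^+ 2) <= v 0 0].

Definition lorentzian (R : realType) (V : vectType R) (C : set V) : Prop :=
  exists (n : nat) (f : 'Hom('rV[R]_n.+1, V)), cone_iso (@lorentz_cone R n) C f.

Definition pos_maps (R : realType) (V1 V2 : vectType R)
    (C1 : set V1) (C2 : set V2) : set 'Hom(V1, V2) :=
  [set P : 'Hom(V1, V2) | P @` C1 `<=` C2].

Definition conv_hull (R : realType) (E : lmodType R) (A : set E) : set E :=
  [set x : E | exists (n : nat) (t : 'I_n -> R) (a : 'I_n -> E),
     [/\ forall i, 0 <= t i, \sum_(i < n) t i = 1, forall i, A (a i) &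
         x = \sum_(i < n) t i *: a i]].

Definition lor_fact (R : realType) (V1 V2 : vectType R)
    (C1 : set V1) (C2 : set V2) : set 'Hom(V1, V2) :=
  conv_hull [set P : 'Hom(V1, V2) | exists (W : vectType R) (L : set W)
    (alpha : 'Hom(V1, W)) (beta : 'Hom(W, V2)),
    [/\ lorentzian L, pos_maps C1 L alpha, pos_maps L C2 beta &
        P = (beta \o alpha)%VF]].

Definition lorentz_factorization_property (R : realType) (V1 V2 : vectType R)
    (C1 : set V1) (C2 : set V2) : Prop :=
  lor_fact C1 C2 = pos_maps C1 C2.

(* Main.v *)
Require Import Defs.
From mathcomp Require Import all_boot all_order all_algebra perm.
From mathcomp Require Import boolp classical_sets reals topology normedtype.
From mathcomp Require Import sequences exp lra ring.

Set Implicit Arguments.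
Unset Strict Implicit.
Unset Printing Implicit Defensive.

Import Order.TTheory GRing.Theory Num.Theory.
Import numFieldNormedType.Exports.
Import VectorInternalTheory.

Local Open Scope classical_set_scope.
Local Open Scope ring_scope.

(* Let G be the automorphism group of the selfdual homogeneous cone C; it is
   stable under transposition. On the interior of C, the function x0 g |-> |det g|
   is log-concave, and the point e of least norm where it is at least 1 has an
   orthogonal stabiliser. Looking at the elements g^T g of G with e g close to e,
   one finds for each v a unique symmetric operator L(v) in the Lie algebra of G
   with e L(v) = v; these operators make V a Euclidean Jordan algebra with unit e,
   in which squares lie in C, orthogonal elements of C have product 0, and spectral
   decompositions exist.

   A positive map from the square cone to C is a triple (s, a, b) with s + a, s - a,
   s + b and s - b in C. By homogeneity and a limit one may take s = e, and by
   spectral decomposition and convexity a^2 = b^2 = e. Then w = a b operator-commutes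
   with a and b, and on the eigenspace of w for the eigenvalue l the square of
   y a + z b is y^2 + 2 l y z + z^2 times an idempotent, so that the restriction of
   the map factors through a Lorentz cone. *)

(** * Limits of matrices along an ultrafilter *)

(** The obstacle is to extract infinitesimal information from homogeneity alone: orbits provide
    group elements with a prescribed action on e, but no smooth family of them. Strict convexity
    replaces smoothness. Log-concavity of |det| is made quantitative, which near e bounds the
    displacement of the Jordan inverse of x by that of x; together with the uniqueness of L(v) this
    keeps the difference quotients of g^T g bounded. Passing from g to g^T g removes the orthogonal
    ambiguity in g. The Lie algebra is described by a linear condition on orthogonal pairs in C that
    survives conjugation and limits, hence also brackets with tangent vectors. Symmetries are the
    right extreme case because the linearised Jordan identity [L(x^2), L(y)] = 2 [L(x), L(xy)] has
    zero left side when x^2 = e, so that L(ab) commutes with L(a) and L(b). The square cone enters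
    at the very end: for |l| <= 1 the form y^2 + 2 l y z + z^2 is at most (|y| + |z|)^2, so the
    square cone lies in the cone of the form. *)

Section EntrywiseLimits.
Variables (R : realType) (U : set_system nat).
Hypothesis UU : UltraFilter U.

#[local] Instance limits_proper : ProperFilter U := ultra_proper.

Lemma ultra_bounded_cvg (u : nat -> R) (M : R) :
  (\forall k \near U, `|u k| <= M) -> exists l : R, u @ U --> l.
Proof.
move=> uM.
have uUU : UltraFilter (u @ U).
  split; first exact: fmap_proper_filter.
  move=> G GF uG; rewrite predeqE => A; split=> [GA|]; last exact: uG.
  have [//|UA] := in_ultra_setVsetC (u @^-1` A) UU.
  have /filter_ex[x []//] : G (A `&` ~` A) by apply: filterI => //; exact: uG.
have := @segment_compact R (- M) M; rewrite compact_ultra => /(_ _ uUU)[].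
  by apply: filterS uM => k; rewrite /= in_itv /= ler_norml.
by move=> l [_ ?]; exists l.
Qed.

Lemma cvg_ge_near (u : nat -> R) (l c : R) :
  u @ U --> l -> (\forall k \near U, c <= u k) -> c <= l.
Proof. move=> ul cu; exact: (@closed_cvg _ _ U _ u (fun x : R => c <= x) (@closed_ge _ c) cu l ul). Qed.

Lemma cvg_le_near (u : nat -> R) (l c : R) :
  u @ U --> l -> (\forall k \near U, u k <= c) -> l <= c.
Proof. move=> ul cu; exact: (@closed_cvg _ _ U _ u (fun x : R => x <= c) (@closed_le _ c) cu l ul). Qed.

Lemma cvg_uniq (u : nat -> R) (l l' : R) : u @ U --> l -> u @ U --> l' -> l = l'.
Proof. by move=> ul ul'; apply: (@norm_cvg_unique _ _ (u @ U) _). Qed.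

Lemma cvg_gt_near (u : nat -> R) (l c : R) :
  u @ U --> l -> c < l -> \forall k \near U, c < u k.
Proof. by move=> ul cl; apply: (cvgr_gt l ul). Qed.

Lemma cvg_lt_near (u : nat -> R) (l c : R) :
  u @ U --> l -> l < c -> \forall k \near U, u k < c.
Proof. by move=> ul cl; apply: (cvgr_lt l ul). Qed.

(* Limits are entrywise along an ultrafilter, so that every bounded sequence of
   matrices converges and no subsequence has to be extracted. *)
Definition mcvg m n (A : nat -> 'M[R]_(m, n)) (B : 'M[R]_(m, n)) :=
  forall i j, (fun k => A k i j) @ U --> B i j.

Lemma mcvg_bounded m n (A : nat -> 'M[R]_(m, n)) (M : R) :
  (\forall k \near U, forall i j, `|A k i j| <= M) -> exists B, mcvg A B.
Proof.
move=> AM; have /choice[f fP] : forall ij : 'I_m * 'I_n,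
    exists l : R, (fun k => A k ij.1 ij.2) @ U --> l.
  by move=> ij; apply: (@ultra_bounded_cvg _ M); apply: filterS AM => k; apply.
by exists (\matrix_(i, j) f (i, j)) => i j; rewrite mxE; exact: (fP (i, j)).
Qed.

Lemma mcvg_uniq m n (A : nat -> 'M[R]_(m, n)) B B' : mcvg A B -> mcvg A B' -> B = B'.
Proof. by move=> AB AB'; apply/matrixP => i j; apply: cvg_uniq (AB i j) (AB' i j). Qed.

Lemma mcvg_near m n (A B : nat -> 'M[R]_(m, n)) C :
  (\forall k \near U, A k = B k) -> mcvg A C -> mcvg B C.
Proof.
move=> AB AC i j; apply: cvg_trans (AC i j); apply: near_eq_cvg.
by apply: filterS AB => k ->.
Qed.

Lemma mcvg_cst m n (B : 'M[R]_(m, n)) : mcvg (fun=> B) B.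
Proof. by move=> i j; exact: cvg_cst. Qed.

Lemma mcvgD m n (A A' : nat -> 'M[R]_(m, n)) B B' :
  mcvg A B -> mcvg A' B' -> mcvg (fun k => A k + A' k) (B + B').
Proof.
move=> AB AB' i j; rewrite mxE; under eq_fun do rewrite mxE.
by apply: cvgD; [exact: AB|exact: AB'].
Qed.

Lemma mcvgZ m n (a : nat -> R) (A : nat -> 'M[R]_(m, n)) (b : R) B :
  a @ U --> b -> mcvg A B -> mcvg (fun k => a k *: A k) (b *: B).
Proof.
move=> ab AB i j; rewrite mxE; under eq_fun do rewrite mxE.
by apply: cvgM; [exact: ab|exact: AB].
Qed.

Lemma mcvgN m n (A : nat -> 'M[R]_(m, n)) B : mcvg A B -> mcvg (fun k => - A k) (- B).
Proof.
by move=> AB i j; rewrite mxE; under eq_fun do rewrite mxE; apply: cvgN; exact: AB.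
Qed.

Lemma mcvgB m n (A A' : nat -> 'M[R]_(m, n)) B B' :
  mcvg A B -> mcvg A' B' -> mcvg (fun k => A k - A' k) (B - B').
Proof. by move=> AB /mcvgN AB'; exact: mcvgD. Qed.

Lemma cvg_sumU (I : Type) (s : seq I) (P : pred I) (f : I -> nat -> R) (g : I -> R) :
  (forall i, P i -> f i @ U --> g i) ->
  (fun k => \sum_(i <- s | P i) f i k) @ U --> \sum_(i <- s | P i) g i.
Proof. by apply: cvg_big => x; exact: add_continuous. Qed.

Lemma cvg_prodU (I : Type) (s : seq I) (P : pred I) (f : I -> nat -> R) (g : I -> R) :
  (forall i, P i -> f i @ U --> g i) ->
  (fun k => \prod_(i <- s | P i) f i k) @ U --> \prod_(i <- s | P i) g i.
Proof. by apply: cvg_big => x; exact: mul_continuous. Qed.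

Lemma mcvgM m n p (A : nat -> 'M[R]_(m, n)) (A' : nat -> 'M[R]_(n, p)) B B' :
  mcvg A B -> mcvg A' B' -> mcvg (fun k => A k *m A' k) (B *m B').
Proof.
move=> AB AB' i j; rewrite mxE; under eq_fun do rewrite mxE.
by apply: cvg_sumU => l _; apply: cvgM; [exact: AB|exact: AB'].
Qed.

Lemma mcvg_tr m n (A : nat -> 'M[R]_(m, n)) B : mcvg A B -> mcvg (fun k => (A k)^T) B^T.
Proof. by move=> AB i j; rewrite mxE; under eq_fun do rewrite mxE; exact: AB. Qed.

Lemma cvg_det n (A : nat -> 'M[R]_n) B : mcvg A B -> (fun k => \det (A k)) @ U --> \det B.
Proof.
move=> AB; apply: cvg_sumU => s _; apply: cvgM; first exact: cvg_cst.
by apply: cvg_prodU => i _; exact: AB.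
Qed.

Lemma cvg_near_cst (u : nat -> R) (l c : R) :
  u @ U --> l -> (\forall k \near U, u k = c) -> l = c.
Proof.
move=> ul uc; apply: le_anti; apply/andP; split.
  by apply: (cvg_le_near ul); apply: filterS uc => k ->.
by apply: (cvg_ge_near ul); apply: filterS uc => k ->.
Qed.

(** An ultrafilter decides every comparison, so u is either O(d) or eventually above each multiple
    of d; [tang_span] uses this to separate the possible scales of a displacement. *)
Lemma ultra_dichotomy (u d : nat -> R) :
  (exists M, \forall k \near U, u k <= M * d k) \/
  (forall M, \forall k \near U, M * d k < u k).
Proof.
have [[M hM]|no] := pselect (exists M, \forall k \near U, u k <= M * d k); first by left; exists M.
right=> M; have [h|h] := in_ultra_setVsetC [set k | u k <= M * d k] UU.
  by case: no; exists M.
by apply: filterS h => k /= /negP; rewrite -ltNge.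
Qed.

End EntrywiseLimits.
Arguments mcvg_cst {R U} UU {m n} B.

(** * The standard inner product on row vectors *)

Section Dot.
Variables (R : realType) (n : nat).
Implicit Types (x y : 'rV[R]_n) (A : 'M[R]_n).

Definition dot x y : R := (x *m y^T) 0 0.

Lemma dotE x y : dot x y = \sum_i x 0 i * y 0 i.
Proof. by rewrite /dot mxE; apply: eq_bigr => i _; rewrite mxE. Qed.

Lemma dotC x y : dot x y = dot y x.
Proof. by rewrite !dotE; apply: eq_bigr => i _; rewrite mulrC. Qed.

Lemma dotDl x x' y : dot (x + x') y = dot x y + dot x' y.
Proof. by rewrite /dot mulmxDl mxE. Qed.

Lemma dotDr x y y' : dot x (y + y') = dot x y + dot x y'.
Proof. by rewrite dotC dotDl !(dotC _ x). Qed.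

Lemma dotZl a x y : dot (a *: x) y = a * dot x y.
Proof. by rewrite /dot -scalemxAl mxE. Qed.

Lemma dotZr a x y : dot x (a *: y) = a * dot x y.
Proof. by rewrite dotC dotZl dotC. Qed.

Lemma dotNl x y : dot (- x) y = - dot x y.
Proof. by rewrite -scaleN1r dotZl mulN1r. Qed.

Lemma dotNr x y : dot x (- y) = - dot x y.
Proof. by rewrite dotC dotNl dotC. Qed.

Lemma dot0l y : dot 0 y = 0.
Proof. by rewrite -(scale0r 0) dotZl mul0r. Qed.

Lemma dot0r x : dot x 0 = 0.
Proof. by rewrite dotC dot0l. Qed.

Lemma dotBl x x' y : dot (x - x') y = dot x y - dot x' y.
Proof. by rewrite dotDl dotNl. Qed.

Lemma dotBr x y y' : dot x (y - y') = dot x y - dot x y'.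
Proof. by rewrite dotDr dotNr. Qed.

Definition dotL := (dotDl, dotDr, dotNl, dotNr, dotZl, dotZr, dot0l, dot0r).

Lemma dot_suml (I : Type) (s : seq I) (P : pred I) (F : I -> 'rV[R]_n) y :
  dot (\sum_(i <- s | P i) F i) y = \sum_(i <- s | P i) dot (F i) y.
Proof. by elim/big_rec2: _ => [|i a b _ <-]; rewrite ?dot0l ?dotDl. Qed.

Lemma dot_mulr x y A : dot (x *m A) y = dot x (y *m A^T).
Proof. by rewrite /dot trmx_mul trmxK mulmxA. Qed.

Lemma dot_ge0 x : 0 <= dot x x.
Proof. by rewrite dotE; apply: sumr_ge0 => i _; rewrite -expr2 sqr_ge0. Qed.

Lemma dot_eq0 x : (dot x x == 0) = (x == 0).
Proof.
apply/eqP/eqP => [|->]; last exact: dot0l.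
rewrite dotE => /psumr_eq0P x0; apply/rowP => i; rewrite mxE; apply/eqP.
by rewrite -sqrf_eq0 expr2 x0 // => j _; rewrite -expr2 sqr_ge0.
Qed.

Lemma dot_gt0 x : (0 < dot x x) = (x != 0).
Proof. by rewrite lt_def dot_ge0 andbT dot_eq0. Qed.

Lemma dot_orth0 x : (forall y, dot x y = 0) -> x = 0.
Proof. by move=> x0; apply/eqP; rewrite -dot_eq0 x0. Qed.

Lemma entry_dot x i : `|x 0 i| ^+ 2 <= dot x x.
Proof.
rewrite dotE (bigD1 i) //= -normrX ger0_norm ?sqr_ge0 // expr2 lerDl.
by apply: sumr_ge0 => j _; rewrite -expr2 sqr_ge0.
Qed.

Lemma dot_delta x i : dot x (delta_mx 0 i) = x 0 i.
Proof.
rewrite dotE (bigD1 i) //= mxE !eqxx mulr1 big1 ?addr0 // => j ji.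
by rewrite mxE (negPf ji) andbF mulr0.
Qed.

Lemma cvg_dot (U : set_system nat) (UU : UltraFilter U) (x y : nat -> 'rV[R]_n) a b :
  mcvg U x a -> mcvg U y b -> (fun k => dot (x k) (y k)) @ U --> dot a b.
Proof. by move=> xa yb; exact: (mcvgM UU xa (mcvg_tr yb)). Qed.

Lemma mcvg_dot_bounded (U : set_system nat) (UU : UltraFilter U) (x : nat -> 'rV[R]_n) M :
  (\forall k \near U, dot (x k) (x k) <= M) -> exists a, mcvg U x a.
Proof.
move=> xM; apply: (@mcvg_bounded _ _ UU _ _ _ (M + 1)).
have FU := ultra_proper (UltraFilter := UU).
apply: filterS xM => k xM i j; rewrite ord1.
have h := le_trans (entry_dot (x k) j) xM.
have h0 := normr_ge0 (x k 0 j); set t := `|_| in h h0 *.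
rewrite leNgt; apply/negP => Mt; nra.
Qed.

End Dot.

(** * Free ultrafilters and attained suprema *)

Section Ultra.
Variable R : realType.

Definition inv_seq (k : nat) : R := k.+1%:R^-1.

Lemma inv_seq_gt0 k : 0 < inv_seq k.
Proof. by rewrite invr_gt0. Qed.

(** The limit clause encodes freeness: U is not principal, and 1/(k+1) is the standard
    infinitesimal. *)
Definition free_ultra (U : set_system nat) :=
  UltraFilter U /\ inv_seq @ U --> (0 : R).

Lemma exists_free_ultra : exists U, free_ultra U.
Proof.
have [U [UU sU]] := @ultraFilterLemma nat \oo _.
exists U; split=> //; apply: cvg_trans (@cvg_harmonic R).
by apply: cvg_app.
Qed.

Lemma sup_attained (U : set_system nat) (S : set R) :
  free_ultra U -> has_sup S -> exists2 u : nat -> R, forall k, S (u k) & u @ U --> sup S.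
Proof.
move=> [UU inv0] supS.
have /choice[u uP] (k : nat) : exists u, S u /\ sup S - inv_seq k < u.
  have [x Sx ltx] := sup_adherent (inv_seq_gt0 k) supS.
  by exists x.
exists u => [k|]; first by case: (uP k).
have ub k : u k <= sup S by apply: ub_le_sup; [exact: supS.2|case: (uP k)].
apply: (@squeeze_cvgr _ U _ _ (fun k => sup S - inv_seq k) (fun=> sup S)).
- by apply: nearW => k; rewrite ub (ltW (uP k).2).
- rewrite -[X in _ --> X]subr0; apply: cvgB; [exact: cvg_cst|exact: inv0].
- exact: cvg_cst.
Qed.

End Ultra.

(** * Continuity of matrix inversion *)

Section Inverse.
Variables (R : realType) (U : set_system nat).
Hypothesis UU : UltraFilter U.
#[local] Instance inverse_proper : ProperFilter U := ultra_proper.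

Lemma mcvg_adj n (A : nat -> 'M[R]_n) B : mcvg U A B -> mcvg U (fun k => \adj (A k)) (\adj B).
Proof.
move=> AB i j; rewrite mxE; under eq_fun do rewrite mxE.
apply: cvgM; first exact: cvg_cst.
apply: cvg_det => i' j'; rewrite !mxE; under eq_fun do rewrite !mxE.
exact: AB.
Qed.

Lemma mcvg_unit n (A : nat -> 'M[R]_n) B : mcvg U A B -> B \in unitmx ->
  \forall k \near U, A k \in unitmx.
Proof.
move=> AB; rewrite unitmxE unitfE -normr_gt0 => dB.
have /(cvg_gt_near UU)/(_ dB) : (fun k => `|\det (A k)|) @ U --> `|\det B|.
  by apply: cvg_norm; exact: cvg_det.
by apply: filterS => k; rewrite unitmxE unitfE normr_gt0.
Qed.

Lemma mcvg_inv n (A : nat -> 'M[R]_n) B : mcvg U A B -> B \in unitmx ->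
  mcvg U (fun k => invmx (A k)) (invmx B).
Proof.
move=> AB uB; have := uB; rewrite /invmx => -> .
apply: (@mcvg_near _ _ UU _ _ (fun k => (\det (A k))^-1 *: \adj (A k))).
  by apply: filterS (mcvg_unit AB uB) => k ->.
apply: mcvgZ => //; last exact: mcvg_adj.
by apply: cvgV; [move: uB; rewrite unitmxE unitfE|exact: cvg_det].
Qed.

End Inverse.

(** * Spectral theory of symmetric matrices *)

Section Rayleigh.
Variables (R : realType) (n : nat).
Implicit Types (x y : 'rV[R]_n) (A K : 'M[R]_n).

Lemma dot_mulC x y A : A^T = A -> dot (x *m A) y = dot (y *m A) x.
Proof. by move=> sA; rewrite dot_mulr sA dotC. Qed.

Lemma normalize x : x != 0 -> exists2 a, 0 < a & dot (a *: x) (a *: x) = 1.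
Proof.
rewrite -dot_gt0 => x0; exists (Num.sqrt (dot x x))^-1; first by rewrite invr_gt0 sqrtr_gt0.
rewrite dotZl dotZr mulrA -expr2 exprVn sqr_sqrtr ?ltW // mulVf //; exact: lt0r_neq0.
Qed.

Lemma quad_bounded A : exists M, forall x, dot x x <= 1 -> dot (x *m A) x <= M.
Proof.
exists (\sum_i \sum_j `|A j i|) => x x1.
have e1 i : `|x 0 i| <= 1.
  have := le_trans (entry_dot x i) x1; have := normr_ge0 (x 0 i).
  set t := `|_| => t0 t1; rewrite leNgt; apply/negP => ?; nra.
rewrite dotE; apply: ler_sum => i _; rewrite mxE mulr_suml; apply: ler_sum => j _.
apply: le_trans (ler_norm _) _; rewrite !normrM.
have := e1 i; have := e1 j; have := normr_ge0 (A j i).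
have := normr_ge0 (x 0 i); have := normr_ge0 (x 0 j).
set a := `|x 0 j|; set b := `|x 0 i|; set c := `|_| => ? ? ? ? ?.
have : a * b <= 1 by nra.
nra.
Qed.

(* Here and below [K] stands for the invariant subspace [ker K]. *)
Lemma psd_null A K x : A^T = A -> (forall y, y *m K = 0 -> y *m A *m K = 0) ->
  (forall y, y *m K = 0 -> 0 <= dot (y *m A) y) -> x *m K = 0 ->
  dot (x *m A) x = 0 -> x *m A = 0.
Proof.
move=> sA AK psd xK x0; apply/eqP; rewrite -dot_eq0 -[_ == _]negbK; apply/negP => z0.
set z := x *m A in z0 *; have {}z0 : 0 < dot z z by rewrite lt_def z0 dot_ge0.
have key t : 0 <= t * (2 * dot z z + t * dot (z *m A) z).
  have := psd (x + t *: z); rewrite mulmxDl -scalemxAl xK -/z (AK _ xK) scaler0 addr0.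
  move=> /(_ erefl); rewrite mulmxDl -scalemxAl -/z !dotL x0.
  rewrite (dot_mulC z x sA) -/z => h; lra.
set c := dot (z *m A) z in key; set d := dot z z in key z0.
have c0 : 0 <= c by apply: psd; rewrite /z AK.
(* For t = -d/(c+1) the factor 2d + tc stays positive while t < 0; the 1 in the denominator covers c
   = 0. *)
have := key (- d / (c + 1)); rewrite leNgt => /negP; apply.
rewrite nmulr_rlt0 ?pmulr_llt0 ?invr_gt0 ?oppr_lt0 //; last by lra.
rewrite -mulrA mulNr.
have -> : 2 * d - d * ((c + 1)^-1 * c) = d * (2 - c / (c + 1)) by ring.
apply: mulr_gt0 => //; rewrite subr_gt0 ltr_pdivrMr; lra.
Qed.

(** A maximiser of the quadratic form on the unit sphere of the subspace is a null vector of the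
    positive semidefinite l - A, hence an eigenvector by [psd_null]. Restricting to ker K makes it
    possible to find eigenvectors of A inside eigenspaces of a matrix commuting with A. *)
Lemma rayleigh A K x0 : A^T = A -> (forall x, x *m K = 0 -> x *m A *m K = 0) ->
  x0 != 0 -> x0 *m K = 0 ->
  exists l x, [/\ x != 0, x *m K = 0, x *m A = l *: x &
    forall y, y *m K = 0 -> dot (y *m A) y <= l * dot y y].
Proof.
move=> sA AK x0n x0K; have [U UU] := exists_free_ultra R.
have [M AM] := quad_bounded A.
pose S : set R := [set v | exists x, [/\ dot x x = 1, x *m K = 0 & v = dot (x *m A) x]].
have supS : has_sup S.
  split; last by exists M => v [x [x1 _ ->]]; apply: AM; rewrite x1.
  have [a a0 a1] := normalize x0n; exists (dot (a *: x0 *m A) (a *: x0)), (a *: x0).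
  by split=> //; rewrite -scalemxAl x0K scaler0.
have [v vS vl] := sup_attained UU supS; have [{}UU _] := UU.
have /choice[x xP] := vS.
have [y xy] : exists y, mcvg U x y.
  apply: (@mcvg_dot_bounded _ _ _ UU _ 1).
  have FU := ultra_proper (UltraFilter := UU).
  by apply: nearW => k; case: (xP k) => ->.
have y1 : dot y y = 1.
  apply: cvg_uniq (cvg_dot UU xy xy) _.
  under eq_fun => k do case: (xP k) => -> _ _.
  by apply: cvg_cst; have := ultra_proper (UltraFilter := UU).
have yK : y *m K = 0.
  have xK0 : (fun k => x k *m K) = fun=> 0 by apply/funext => k; case: (xP k).
  have := mcvgM UU xy (mcvg_cst UU K); rewrite /= xK0 => h.
  exact: (mcvg_uniq UU h (mcvg_cst UU _)).
have yS : sup S = dot (y *m A) y.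
  apply: cvg_uniq vl _.
  have -> : v = fun k => dot (x k *m A) (x k) by apply/funext => k; case: (xP k).
  by apply: cvg_dot => //; apply: mcvgM => //; apply: mcvg_cst.
have y0 : y != 0 by rewrite -dot_gt0 y1.
have maxS z : z *m K = 0 -> dot (z *m A) z <= sup S * dot z z.
  move=> zK; have [->|z0] := eqVneq z 0; first by rewrite !dot0r mulr0.
  have [a a0 a1] := normalize z0.
  have : dot (a *: z *m A) (a *: z) <= sup S.
    apply: ub_le_sup; first exact: supS.2.
    by exists (a *: z); split => //; rewrite -scalemxAl zK scaler0.
  rewrite -scalemxAl !dotZl !dotZr in a1 *.
  rewrite mulrA in a1; rewrite mulrA => h.
  rewrite -(ler_pM2l (mulr_gt0 a0 a0)) mulrCA a1 mulr1 //.
exists (sup S), y; split=> //.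
apply/eqP; rewrite eq_sym -subr_eq0; apply/eqP.
have -> : sup S *: y - y *m A = y *m ((sup S)%:M - A) by rewrite mulmxBr mul_mx_scalar.
apply: (@psd_null _ K) => //.
- by rewrite linearB /= sA tr_scalar_mx.
- by move=> z zK; rewrite mulmxBr mul_mx_scalar mulmxBl -scalemxAl zK AK // scaler0 subr0.
- by move=> z zK; rewrite mulmxBr mul_mx_scalar dotBl dotZl subr_ge0 maxS.
- by rewrite mulmxBr mul_mx_scalar dotBl dotZl y1 mulr1 yS subrr.
Qed.

Lemma sym_eq0 A : A^T = A -> (forall l x, x != 0 -> x *m A = l *: x -> l = 0) -> A = 0.
Proof.
move=> sA ev0.
have key B : B^T = B -> (forall l x, x != 0 -> x *m B = l *: x -> l = 0) ->
    forall y, dot (y *m B) y <= 0.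
  move=> sB Bev y; have [->|y0] := eqVneq y 0; first by rewrite dot0r.
  have [l [x [x0 _ xB By]]] := @rayleigh B 0 y sB (fun z _ => mulmx0 _ (z *m B)) y0 (mulmx0 _ y).
  by have := By y (mulmx0 _ y); rewrite (Bev _ _ x0 xB) mul0r.
have A0 y : dot (y *m A) y = 0.
  apply: le_anti; rewrite (key _ sA ev0) /=.
  have := key (- A); rewrite linearN /= sA => /(_ erefl) h.
  rewrite -oppr_le0 -dotNl -mulmxN; apply: h => l x x0; rewrite mulmxN => xA.
  by apply/eqP; rewrite -oppr_eq0; apply/eqP/(ev0 _ x x0); rewrite scaleNr -xA opprK.
apply/row_matrixP => i; rewrite row0 rowE.
apply: (@psd_null A 0) => //; rewrite ?mulmx0 // => y _; rewrite ?mulmx0 //.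
by rewrite A0.
Qed.

End Rayleigh.

Section Spectrum.
Variables (R : realType) (n : nat).
Implicit Types (x y : 'rV[R]_n.+1) (A : 'M[R]_n.+1) (p : {poly R}).

Lemma horner_mx_sym A p : A^T = A -> (horner_mx A p)^T = horner_mx A p.
Proof.
move=> sA; elim/poly_ind: p => [|p c IH]; first by rewrite !raddf0.
rewrite rmorphD rmorphM /= horner_mx_X horner_mx_C linearD /= tr_scalar_mx -mulmxE trmx_mul.
by rewrite IH sA -(comm_horner_mx p (erefl (A *m A))).
Qed.

Lemma horner_mx_eig A p x l : x *m A = l *: x -> x *m horner_mx A p = p.[l] *: x.
Proof.
move=> xA; elim/poly_ind: p => [|p c IH]; first by rewrite raddf0 horner0 mulmx0 scale0r.
rewrite rmorphD rmorphM /= horner_mx_X horner_mx_C mulmxDr -mulmxE mulmxA IH.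
by rewrite -scalemxAl xA mul_mx_scalar !hornerE scalerA scalerDl.
Qed.

(** Otherwise eigenvalues could be added forever: M, the product evaluated at A, is symmetric and
    nonzero, so it has an eigenvalue mu <> 0; an eigenvector of A inside that eigenspace of M cannot
    belong to a listed eigenvalue, as M would kill it. But n.+2 eigenvalues exceed the degree of the
    characteristic polynomial. *)
Lemma sym_spectrum A : A^T = A ->
  exists2 s : seq R, uniq s & horner_mx A (\prod_(l <- s) ('X - l%:P)) = 0.
Proof.
move=> sA; apply: contrapT => noS.
have grow m : exists s, [/\ uniq s, size s = m & all (eigenvalue A) s].
  elim: m => [|m [s [us sm As]]]; first by exists [::].
  set M := horner_mx A (\prod_(l <- s) ('X - l%:P)).
  have sM : M^T = M by exact: horner_mx_sym.
  have [mu [x [x0 [mu0 xM]]]] : exists mu x, x != 0 /\ mu != 0 /\ x *m M = mu *: x.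
    apply: contrapT => no; apply: noS; exists s => //; apply: sym_eq0 => // l x x0 xl.
    by apply: contrapT => /eqP l0; apply: no; exists l, x.
  have AK : forall z : 'rV[R]_n.+1, z *m (M - mu%:M) = 0 -> z *m A *m (M - mu%:M) = 0.
    have AM : A *m M = M *m A by apply: comm_mx_horner.
    move=> z zK; have AMmu : A *m (M - mu%:M) = (M - mu%:M) *m A.
      by rewrite mulmxBl mulmxBr AM mul_mx_scalar mul_scalar_mx.
    by rewrite -mulmxA AMmu mulmxA zK mul0mx.
  have xK : x *m (M - mu%:M) = 0 by rewrite mulmxBr mul_mx_scalar xM subrr.
  have [l [y [y0 yK yA _]]] := rayleigh sA AK x0 xK.
  exists (l :: s); split => /=; first last.
  - by rewrite As andbT; apply/eigenvalueP; exists y.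
  - by rewrite sm.
  rewrite us andbT; apply/negP => ls.
  have : y *m M = 0.
    rewrite (horner_mx_eig _ yA) (big_rem l) //= hornerM !hornerE subrr mul0r scale0r //.
  move: yK; rewrite mulmxBr mul_mx_scalar => /eqP; rewrite subr_eq0 => /eqP -> /eqP.
  by rewrite scaler_eq0 (negPf mu0) (negPf y0).
have [s [us sn As]] := grow n.+2.
have := @max_poly_roots _ (char_poly A) s.
rewrite size_char_poly sn ltnn => h.
suff : false by [].
apply: h => //; first by rewrite monic_neq0 // char_poly_monic.
by apply: sub_all As => l; rewrite eigenvalue_root_char.
Qed.

(** Lagrange interpolation at the roots of the annihilating polynomial. The projections are kept as
    polynomials in A so that they commute with whatever commutes with A. Some may be zero, since the
    listed roots need not all be eigenvalues. *)
Lemma spectral_poly A : A^T = A ->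
  exists (m : nat) (l : 'I_m -> R) (p : 'I_m -> {poly R}),
  [/\ \sum_i horner_mx A (p i) = 1%:M,
      forall i, horner_mx A (p i) *m horner_mx A (p i) = horner_mx A (p i),
      forall i j, i != j -> horner_mx A (p i) *m horner_mx A (p j) = 0 &
      forall i, A *m horner_mx A (p i) = l i *: horner_mx A (p i)].
Proof.
move=> sA; have [s us sA0] := sym_spectrum sA.
set m := size s; pose l (i : 'I_m) := s`_i.
have linj : injective l by move=> i j /eqP; rewrite nth_uniq // => /eqP/val_inj.
have prodl : \prod_(i < m) ('X - (l i)%:P) = \prod_(l <- s) ('X - l%:P).
  by rewrite [RHS](big_nth 0) big_mkord.
pose q i := \prod_(j < m | j != i) ('X - (l j)%:P).
have qi0 i : (q i).[l i] != 0.
  rewrite /q horner_prod prodf_seq_neq0; apply/allP => j _; apply/implyP => ji.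
  by rewrite !hornerE subr_eq0; apply/negP => /eqP/linj/eqP; rewrite eq_sym (negPf ji).
have qj i j : i != j -> (q i).[l j] = 0.
  move=> ij; rewrite /q horner_prod (bigD1 j) ?(eq_sym j) //= !hornerE subrr mul0r //.
pose p i := (q i).[l i]^-1 *: q i.
have sizeq i : (size (q i) <= m)%N.
  rewrite /q size_prod; last by move=> j _; rewrite polyXsubC_eq0.
  under eq_bigr do rewrite size_XsubC.
  rewrite sum_nat_const; have -> : #|(fun j : 'I_m => j != i)| = m.-1.
    by rewrite cardC1 card_ord.
  by case: (m) i => [[]//|k _] /=; rewrite muln2 -addnn subSn ?leq_addr // addnK.
have sump : \sum_i p i = 1.
  apply/eqP; rewrite -subr_eq0; apply/negPn/negP => P0.
  have := @max_poly_roots _ _ s P0 _ us; rewrite -/m.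
  have -> : all (root (\sum_i p i - 1)) s.
    apply/(all_nthP 0) => i im; rewrite rootE !hornerE horner_sum subr_eq0.
    rewrite (bigD1 (Ordinal im)) //= -[s`_i]/(l (Ordinal im)) hornerZ mulVf // big1 ?addr0 //.
    by move=> j ji; rewrite /p hornerZ (qj _ _ ji) mulr0.
  move=> /(_ isT); rewrite ltnNge => /negP; apply.
  apply: leq_trans (size_polyD _ _) _; rewrite geq_max; apply/andP; split; last first.
    (* The list of roots is nonempty: the empty product evaluates to the identity matrix, which is
       not 0. *)
    rewrite size_polyN size_poly1 lt0n; apply/eqP => m0; move: P0.
    rewrite /= ; move: sA0; rewrite (size0nil m0) big_nil rmorph1.
    by move=> /matrixP/(_ 0 0); rewrite !mxE eqxx => /eqP; rewrite oner_eq0.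
  apply: leq_trans (size_sum _ _ _) _; apply/bigmax_leqP => i _.
  exact: leq_trans (size_scale_leq _ _) (sizeq i).
have kill i : A *m horner_mx A (p i) = l i *: horner_mx A (p i).
  apply/eqP; rewrite -subr_eq0; apply/eqP.
  have -> : A *m horner_mx A (p i) - l i *: horner_mx A (p i) = horner_mx A (('X - (l i)%:P) * p i).
    rewrite rmorphM rmorphB /= horner_mx_X horner_mx_C -mulmxE mulmxBl mul_scalar_mx //.
  rewrite -scalerAr linearZ /=.
  have -> : ('X - (l i)%:P) * q i = \prod_(l <- s) ('X - l%:P).
    by rewrite -prodl (bigD1 i).
  by rewrite sA0 scaler0.
have orth i j : i != j -> horner_mx A (p i) *m horner_mx A (p j) = 0.
  move=> ij; have : l i *: (horner_mx A (p i) *m horner_mx A (p j)) =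
      l j *: (horner_mx A (p i) *m horner_mx A (p j)).
    rewrite scalemxAl -kill [RHS]scalemxAr -kill mulmxA; congr (_ *m _).
    by apply: comm_mx_horner.
  move=> /eqP; rewrite -subr_eq0 -scalerBl scaler_eq0 subr_eq0 => /orP[/eqP/linj/eqP|/eqP//].
  by rewrite (negPf ij).
have sumE : \sum_i horner_mx A (p i) = 1%:M.
  by rewrite -raddf_sum /= sump rmorph1.
exists m, l, p; split=> // i.
rewrite -[RHS]mulmx1 -sumE mulmx_sumr (bigD1 i) //= big1 ?addr0 // => j ji.
by rewrite orth // eq_sym.
Qed.

End Spectrum.

Lemma cauchy_schwarz (R : realType) n (x y : 'rV[R]_n) : dot x y ^+ 2 <= dot x x * dot y y.
Proof.
have [->|y0] := eqVneq y 0; first by rewrite !dot0r expr0n /= mulr0.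
have := dot_ge0 (dot y y *: x - dot x y *: y).
rewrite !dotL (dotC y x) => h; rewrite -dot_gt0 in y0.
rewrite -(ler_pM2l y0) -subr_ge0; apply: le_trans h _; rewrite le_eqVlt; apply/orP; left.
by apply/eqP; ring.
Qed.

(** * Matrix and scalar estimates *)

Section MatrixFacts.
Variables (R : realType) (n : nat).

Lemma det_bounded (c : R) : exists M, forall Y : 'M[R]_n.+1,
  (forall i j, `|Y i j| <= c) -> `|\det Y| <= M.
Proof.
exists (\sum_(s : {perm 'I_n.+1}) \prod_(i < n.+1) c) => Y Yc.
apply: le_trans (ler_norm_sum _ _ _) _; apply: ler_sum => s _.
rewrite normrM normrX normrN1 expr1n mul1r normr_prod; apply: ler_prod => i _.
by rewrite normr_ge0 Yc.
Qed.

Lemma det_row_eq0 (Y : 'M[R]_n.+1) i : row i Y = 0 -> \det Y = 0.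
Proof.
move=> Y0; rewrite (expand_det_row _ i); apply: big1 => j _.
by have /rowP/(_ j) := Y0; rewrite !mxE => ->; rewrite mul0r.
Qed.

(** Plays the part of the arithmetic-geometric mean inequality: each a is at most exp(a - 1). *)
Lemma prod_le_expR (a : 'I_n.+1 -> R) : (forall i, 0 <= a i) ->
  \prod_i a i <= expR (\sum_i (a i - 1)).
Proof.
move=> a0; rewrite expR_sum; apply: ler_prod => i _; rewrite a0 /=.
by have := expR_ge1Dx (a i - 1); rewrite addrC subrK.
Qed.

Lemma mulmx_norm p (v : 'rV[R]_p) (A : 'M[R]_p) :
  dot (v *m A) (v *m A) <= (\sum_i \sum_j A j i ^+ 2) * dot v v.
Proof.
rewrite dotE mulr_suml; apply: ler_sum => i _; rewrite -expr2.
have -> : (v *m A) 0 i = dot v (col i A)^T by rewrite dotE mxE; apply: eq_bigr => j _; rewrite !mxE.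
apply: le_trans (cauchy_schwarz _ _) _; rewrite mulrC ler_wpM2r ?dot_ge0 // le_eqVlt; apply/orP; left.
by rewrite dotE; apply/eqP/eq_bigr => j _; rewrite !mxE expr2.
Qed.

Lemma mulmx_norm_bounded p (M : R) : exists2 K, 0 < K & forall A : 'M[R]_p,
  (forall i j, `|A i j| <= M) -> forall v, dot (v *m A) (v *m A) <= K * dot v v.
Proof.
exists (1 + \sum_(i < p) \sum_(j < p) M ^+ 2).
  by rewrite ltr_pwDl // sumr_ge0 // => i _; rewrite sumr_ge0 // => j _; exact: sqr_ge0.
move=> A AM v; apply: le_trans (mulmx_norm v A) _; rewrite ler_wpM2r ?dot_ge0 //.
rewrite -[leLHS]add0r lerD //; apply: ler_sum => i _; apply: ler_sum => j _.
rewrite -[A j i ^+ 2]ger0_norm ?sqr_ge0 // normrX ler_pXn2r ?nnegrE //.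
exact: le_trans (AM j i).
Qed.

(** With q = (s + t - 2r)/4 the arithmetic-geometric mean inequality turns the last hypothesis into
    E r^2 <= q (2r + q), and q <= r/2 bounds the right side by (5/2) r q. The constant 2/5 is not
    sharp. *)
Lemma strong_arith (r s t E : R) : 0 < r -> 0 < s -> 0 < t -> s <= 2 * r -> t <= 2 * r ->
  0 <= E -> (1 + E) * r ^+ 2 <= (s + r) / 2 * ((t + r) / 2) -> 2 / 5 * r * E <= s + t - 2 * r.
Proof.
move=> r0 s0 t0 s2 t2 E0 h3.
have h4 : (1 + E) * r ^+ 2 <= ((s + t + 2 * r) / 4) ^+ 2.
  by apply: le_trans h3 _; have := sqr_ge0 (s - t); lra.
pose q := (s + t - 2 * r) / 4.
have h5 : E * r ^+ 2 <= q * (2 * r + q) by move: h4; rewrite /q; lra.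
have q1 : q <= r / 2 by rewrite /q; lra.
have Er : 0 <= E * r ^+ 2 by rewrite mulr_ge0 ?sqr_ge0.
have q2 : 0 <= q.
  rewrite leNgt; apply/negP => q0; have q3 : 0 < 2 * r + q by rewrite /q; lra.
  by have : q * (2 * r + q) < 0; [rewrite pmulr_llt0|rewrite ltNge (le_trans Er h5)].
have h6 : E * r ^+ 2 <= q * (5 / 2 * r) by apply: le_trans h5 _; rewrite ler_wpM2l //; lra.
have h7 : E * r <= q * (5 / 2) by rewrite -(ler_pM2r r0); move: h6; rewrite expr2; lra.
move: h7 q2; rewrite /q; lra.
Qed.

Lemma expr_bounded (l M : R) : (forall m, l ^+ m <= M) -> l <= 1.
Proof.
move=> lM; rewrite leNgt; apply/negP => l1.
have ber m : 1 + m%:R * (l - 1) <= l ^+ m.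
  elim: m => [|m IH]; first by rewrite mul0r addr0 expr0.
  rewrite exprS -natr1; have m0 : 0 <= m%:R :> R by exact: ler0n.
  by apply: (@le_trans _ _ (l * (1 + m%:R * (l - 1)))); [have := mulr_ge0 m0 (sqr_ge0 (l - 1)); lra|rewrite ler_pM2l //; lra].
have M1 : 1 <= M by have := lM 0%N; rewrite expr0.
have := le_trans (ber (Num.bound (M / (l - 1)))) (lM _).
have := archi_boundP (x := M / (l - 1)); rewrite divr_ge0 ?subr_ge0 ?(ltW l1) ?(le_trans ler01) //.
move=> /(_ isT); rewrite ltr_pdivrMr ?subr_gt0 //.
set b := _%:R => *; lra.
Qed.

Lemma invmxM m (A B : 'M[R]_m) : A \in unitmx -> B \in unitmx ->
  invmx (A *m B) = invmx B *m invmx A.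
Proof.
move=> uA uB; have uAB : A *m B \in unitmx by rewrite unitmx_mul uA.
have h : invmx B *m invmx A *m (A *m B) = 1%:M.
  by rewrite mulmxA -(mulmxA (invmx B)) mulVmx // mulmx1 mulVmx.
by rewrite -[LHS]mul1mx -h mulmxK.
Qed.

(** Greedy extension: while the family is too small, some nonzero u is orthogonal to it, and an
    element of P not orthogonal to u is independent of the family. *)
Lemma basis_from_orth (P : 'rV[R]_n.+1 -> Prop) :
  (forall u, (forall p, P p -> dot u p = 0) -> u = 0) ->
  exists2 B : 'M[R]_n.+1, B \in unitmx & forall i, P (row i B).
Proof.
move=> Porth.
have grow k : (k <= n.+1)%N -> exists2 A : 'M[R]_(k, n.+1), row_free A & forall i, P (row i A).
  elim: k => [|k IH] kn; first by exists 0; rewrite ?/row_free ?mxrank0 // => -[].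
  have [A fA PA] := IH (ltnW kn).
  have [u u0 uA] : exists2 u : 'rV[R]_n.+1, u != 0 & u *m A^T = 0.
    exists (nz_row (kermx A^T)); last by apply/eqP; rewrite -sub_kermx nz_row_sub.
    rewrite nz_row_eq0 -mxrank_eq0 mxrank_ker mxrank_tr subn_eq0 -ltnNge.
    by apply: leq_ltn_trans kn; exact: rank_leq_row.
  have [p Pp up] : exists2 p, P p & dot u p != 0.
    apply: contrapT => no; move/eqP: u0; apply; apply: Porth => p Pp.
    by apply: contrapT => /eqP up; apply: no; exists p.
  have : exists2 A : 'M[R]_(k + 1, n.+1), row_free A & forall i, P (row i A).
    exists (col_mx A p); last first.
      move=> i; case: (splitP i) => j ij.
        by rewrite (_ : i = lshift 1 j) ?rowKu //; exact: val_inj.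
      rewrite (_ : i = rshift k j) ?rowKd; last exact: val_inj.
      by rewrite [j]ord1 row_id.
    rewrite -kermx_eq0; apply/rowV0P => w /sub_kermxP.
    rewrite -[w]hsubmxK mul_row_col => wE.
    have w2 : rsubmx w = 0.
      apply/matrixP => a b; rewrite !ord1 mxE.
      have := congr1 (fun v => dot u v) wE.
      have -> : dot u (lsubmx w *m A + rsubmx w *m p) = dot u (rsubmx w *m p).
        by rewrite dotDr {1}/dot trmx_mul mulmxA uA mul0mx mxE add0r.
      rewrite dot0r [rsubmx w]mx11_scalar mul_scalar_mx dotZr.
      by move=> /eqP; rewrite mulf_eq0 (negPf up) orbF mxE => /eqP; rewrite mxE => ->.
    move: wE; rewrite w2 mul0mx addr0 => /eqP; rewrite mulmx_free_eq0 // => /eqP ->.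
    by rewrite row_mx0.
  by rewrite addn1.
have [B fB PB] := grow _ (leqnn _); exists B => //.
by rewrite -row_free_unit.
Qed.

Lemma mx_eq (A B : 'M[R]_n.+1) : (forall v : 'rV[R]_n.+1, v *m A = v *m B) -> A = B.
Proof. by move=> h; apply/row_matrixP => i; rewrite !rowE. Qed.

End MatrixFacts.

(** * Homogeneous selfdual cones *)

Section SelfdualCone.
Variables (R : realType) (n : nat) (C : set 'rV[R]_n.+1) (U : set_system nat).
Implicit Types (x y z e : 'rV[R]_n.+1) (A g h : 'M[R]_n.+1).
Hypothesis freeU : free_ultra R U.
Hypothesis Cdual : forall y, C y <-> forall x, C x -> 0 <= dot x y.
Hypothesis Cspan : exists2 B : 'M[R]_n.+1, B \in unitmx & forall i, C (row i B).

#[local] Instance cone_ultra : UltraFilter U := freeU.1.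
#[local] Instance cone_proper : ProperFilter U := ultra_proper.
Let UU : UltraFilter U := freeU.1.

(* Strict positivity on the dual cone, which is [C] itself: the interior of [C]. *)
Definition cone_int x := forall y, C y -> y != 0 -> 0 < dot x y.
Definition posm A := forall x, C x -> C (x *m A).
Definition aut g := [/\ g \in unitmx, posm g & posm (invmx g)].

Lemma cone_dot_ge0 x y : C x -> C y -> 0 <= dot x y.
Proof. by move=> Cx /Cdual; exact. Qed.

Lemma cone0 : C 0.
Proof. by apply/Cdual => x _; rewrite dot0r. Qed.

Lemma coneD x y : C x -> C y -> C (x + y).
Proof.
by move=> /Cdual Cx /Cdual Cy; apply/Cdual => z Cz; rewrite dotDr addr_ge0 ?Cx ?Cy.
Qed.

Lemma coneZ a x : 0 <= a -> C x -> C (a *: x).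
Proof. by move=> a0 /Cdual Cx; apply/Cdual => z Cz; rewrite dotZr mulr_ge0 ?Cx. Qed.

Lemma cone_lim (x : nat -> 'rV[R]_n.+1) y :
  mcvg U x y -> (\forall k \near U, C (x k)) -> C y.
Proof.
move=> xy Cx; apply/Cdual => z Cz.
apply: (cvg_ge_near UU (cvg_dot UU (mcvg_cst UU z) xy)).
by apply: filterS Cx => k; exact: cone_dot_ge0.
Qed.

Lemma dot_span0 x : (forall y, C y -> dot x y = 0) -> x = 0.
Proof.
case: Cspan => B uB CB x0; have : x *m B^T = 0.
  apply/rowP => i; rewrite mxE [RHS]mxE -[RHS](x0 (row i B)) // dotE.
  by apply: eq_bigr => j _; rewrite !mxE.
by move=> /(congr1 (fun z => z *m invmx B^T)); rewrite mulmxK ?unitmx_tr // mul0mx.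
Qed.

Lemma cone_pointed x : C x -> C (- x) -> x = 0.
Proof.
move=> Cx CNx; apply: dot_span0 => y Cy; apply: le_anti.
by rewrite cone_dot_ge0 // andbT -oppr_ge0 -dotNl cone_dot_ge0.
Qed.

Lemma posm_tr A : posm A -> posm A^T.
Proof.
move=> pA x Cx; apply/Cdual => y Cy; rewrite -[A in _ *m A^T]trmxK.
by rewrite dotC dot_mulr !trmxK cone_dot_ge0 //; exact: pA.
Qed.

Lemma posmM A B : posm A -> posm B -> posm (A *m B).
Proof. by move=> pA pB x Cx; rewrite mulmxA; apply/pB/pA. Qed.

Lemma posm_lim (A : nat -> 'M[R]_n.+1) B :
  mcvg U A B -> (\forall k \near U, posm (A k)) -> posm B.
Proof.
move=> AB pA x Cx; apply: (cone_lim (mcvgM UU (mcvg_cst UU x) AB)).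
by apply: filterS pA => k; exact.
Qed.

Lemma aut_unit g : aut g -> g \in unitmx. Proof. by case. Qed.
Lemma aut_pos g : aut g -> posm g. Proof. by case. Qed.

Lemma aut_inv g : aut g -> aut (invmx g).
Proof. by move=> [ug pg pgi]; split; rewrite ?unitmx_inv ?invmxK. Qed.

Lemma aut_tr g : aut g -> aut g^T.
Proof. by move=> [ug pg pgi]; split; rewrite ?unitmx_tr -?trmx_inv //; exact: posm_tr. Qed.

Lemma autM g h : aut g -> aut h -> aut (g *m h).
Proof.
move=> [ug pg pgi] [uh ph phi]; split; first by rewrite unitmx_mul ug.
  exact: posmM.
by rewrite invmxM //; exact: posmM.
Qed.

Lemma aut_scalar a : 0 < a -> aut a%:M.
Proof.
move=> a0; split.
- by rewrite unitmxE det_scalar unitfE expf_neq0 // gt_eqF.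
- by move=> x Cx; rewrite mul_mx_scalar; apply: coneZ => //; exact: ltW.
- by move=> x Cx; rewrite invmx_scalar mul_mx_scalar; apply: coneZ; rewrite // invr_ge0 ltW.
Qed.

Lemma aut1 : aut 1%:M.
Proof. exact: aut_scalar. Qed.

Lemma aut_lim (g : nat -> 'M[R]_n.+1) h :
  mcvg U g h -> h \in unitmx -> (\forall k \near U, aut (g k)) -> aut h.
Proof.
move=> gh uh ag; split=> //.
  by apply: posm_lim gh _; apply: filterS ag => k [].
by apply: posm_lim (mcvg_inv UU gh uh) _; apply: filterS ag => k [].
Qed.

Lemma cone_int_sub x : cone_int x -> C x.
Proof.
move=> Ox; apply/Cdual => y Cy; have [->|y0] := eqVneq y 0; first by rewrite dot0l.
by rewrite dotC ltW // Ox.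
Qed.

Lemma cone_intD x y : cone_int x -> C y -> cone_int (x + y).
Proof. by move=> Ox Cy z Cz z0; rewrite dotDl ltr_wpDr ?Ox // cone_dot_ge0. Qed.

Lemma cone_intZ a x : 0 < a -> cone_int x -> cone_int (a *: x).
Proof. by move=> a0 Ox z Cz z0; rewrite dotZl mulr_gt0 // Ox. Qed.

Lemma cone_int_aut x g : cone_int x -> aut g -> cone_int (x *m g).
Proof.
move=> Ox ag y Cy y0; rewrite dot_mulr; apply: Ox; first exact: (aut_pos (aut_tr ag)).
apply: contraNneq y0 => /(congr1 (fun z => z *m invmx g^T)).
by rewrite mulmxK ?unitmx_tr ?mul0mx; [move=> ->|case: ag].
Qed.

Lemma cone_int_ex : exists x, cone_int x.
Proof.
case: (Cspan) => B uB CB; exists (\sum_i row i B) => y Cy y0.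
rewrite dot_suml lt_def sumr_ge0 ?andbT => [|i _]; last exact: cone_dot_ge0.
apply: contra_neq y0 => /psumr_eq0P s0.
have : y *m B^T = 0.
  apply/rowP => i; rewrite mxE [RHS]mxE -[RHS](s0 _ i) // => [|j _]; last exact: cone_dot_ge0.
  by rewrite dotE; apply: eq_bigr => j _; rewrite !mxE mulrC.
by move=> /(congr1 (fun z => z *m invmx B^T)); rewrite mulmxK ?unitmx_tr // mul0mx.
Qed.

Lemma cone_int_neq0 e : cone_int e -> e != 0.
Proof.
move=> Oe; apply/eqP => e0; have C_0 y : C y -> y = 0.
  by move=> Cy; apply: contrapT => /eqP /(Oe y Cy); rewrite e0 dot0l ltxx.
have /matrixP/(_ 0 0)/eqP : const_mx 1 = 0 :> 'rV[R]_n.+1.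
  by apply: dot_span0 => y /C_0 ->; rewrite dot0r.
by rewrite !mxE oner_eq0.
Qed.

(** * Interior points as order units *)

Section OrderUnit.
Variable e : 'rV[R]_n.+1.
Hypothesis Oe : cone_int e.

(** By compactness [dot e] has a positive lower bound d on the unit vectors of C; scaling gives c =
    d^-2. *)
Lemma cone_int_coercive : exists2 c, 0 < c & forall y, C y -> dot y y <= c * dot e y ^+ 2.
Proof.
have [d d0 hd] : exists2 d, 0 < d & forall y, C y -> dot y y = 1 -> d <= dot e y.
  apply: contrapT => no.
  have /choice[y yP] (k : nat) : exists y, [/\ C y, dot y y = 1 & dot e y < inv_seq R k].
    apply: contrapT => no'; apply: no; exists (inv_seq R k); first exact: inv_seq_gt0.
    by move=> y Cy y1; rewrite leNgt; apply/negP => ?; apply: no'; exists y.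
  have [z yz] : exists z, mcvg U y z.
    by apply: (@mcvg_dot_bounded _ _ _ _ _ 1); apply: nearW => k; case: (yP k) => _ ->.
  have Cz : C z by apply: cone_lim yz _; apply: nearW => k; case: (yP k).
  have z1 : dot z z = 1.
    apply: cvg_uniq (cvg_dot UU yz yz) _.
    have -> : (fun k => dot (y k) (y k)) = fun=> 1 by apply/funext => k; case: (yP k).
    exact: cvg_cst.
  have : dot e z <= 0.
    have h : (fun k => dot e (y k) - inv_seq R k) @ U --> dot e z - 0.
      apply: cvgB; [exact: cvg_dot (mcvg_cst UU e) yz|exact: freeU.2].
    rewrite -[dot e z]subr0; apply: (cvg_le_near UU h); apply: nearW => k.
    by case: (yP k) => _ _ /ltW; rewrite subr_le0.
  by rewrite leNgt Oe // -dot_gt0 z1.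
exists (d^-1 ^+ 2); first by rewrite exprn_gt0 // invr_gt0.
move=> y Cy; have [->|y0] := eqVneq y 0; first by rewrite !dot0r expr0n /= mulr0.
have [a a0 a1] := normalize y0.
have := hd (a *: y) (coneZ (ltW a0) Cy) a1; rewrite dotZr => h.
rewrite dotZl dotZr mulrA -expr2 in a1.
rewrite -(ler_pM2l (exprn_gt0 2 a0)) a1 mulrCA -exprMn -exprMn.
by rewrite exprn_ege1 // mulrC ler_pdivlMr // mul1r.
Qed.

Lemma cone_int_ball : exists2 d, 0 < d & forall z, dot z z <= d ->
  forall y, C y -> dot e y <= 2 * dot (e + z) y /\ dot (e + z) y <= 2 * dot e y.
Proof.
(* With this radius Cauchy-Schwarz and coercivity give |dot z y| <= dot e y / 2. *)
have [c c0 cP] := cone_int_coercive; exists (4 * c)^-1; first by rewrite invr_gt0 mulr_gt0.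
move=> z zd y Cy; have cs := cauchy_schwarz z y; have := cP y Cy; have ey := cone_dot_ge0 (cone_int_sub Oe) Cy.
rewrite dotDl => yc.
have : dot z y ^+ 2 <= (dot e y / 2) ^+ 2.
  apply: le_trans cs _; apply: le_trans (ler_pM _ _ zd yc) _; rewrite ?dot_ge0 //.
  rewrite le_eqVlt; apply/orP; left; apply/eqP; field; exact: lt0r_neq0.
rewrite -subr_ge0 subr_sqr => h.
set a := dot e y in h ey *; set b := dot z y in h *.
by split; rewrite leNgt; apply/negP => ?; nra.
Qed.

Lemma cone_int_ball_sub : exists2 d, 0 < d & forall z, dot z z <= d -> C (e + z) /\ C (e - z).
Proof.
have [d d0 dP] := cone_int_ball; exists d => // z zd; split; apply/Cdual => y Cy; rewrite dotC.
  have [h _] := dP z zd y Cy; have := cone_dot_ge0 (cone_int_sub Oe) Cy; lra.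
have := dP (- z); rewrite dotNl dotNr opprK => /(_ zd y Cy)[h _].
have := cone_dot_ge0 (cone_int_sub Oe) Cy; lra.
Qed.

Lemma near_cone_int (x : nat -> 'rV[R]_n.+1) : mcvg U x e -> \forall k \near U,
  cone_int (x k) /\ forall y, C y -> dot e y <= 2 * dot (x k) y /\ dot (x k) y <= 2 * dot e y.
Proof.
move=> xe; have [d d0 dP] := cone_int_ball.
have h : mcvg U (fun k => x k - e) 0 by rewrite -(subrr e); apply: mcvgB xe (mcvg_cst UU e).
have := cvg_dot UU h h; rewrite dot0l => /(cvg_lt_near UU)/(_ d0).
apply: filterS => k /ltW/dP; rewrite addrC subrK => hk; split=> // y Cy y0.
have [+ _] := hk y Cy; have := Oe Cy y0; lra.
Qed.

(** Boundedness of order intervals: add the coercivity bounds for u + y and u - y, using the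
    parallelogram law and |dot e y| <= dot e u. *)
Lemma interval_bounded : exists2 c, 0 < c &
  forall u y, C (u + y) -> C (u - y) -> dot y y <= c * dot e u ^+ 2.
Proof.
have [c c0 cP] := cone_int_coercive; exists (2 * c); first lra.
move=> u y Cp Cm; have := cP _ Cp; have := cP _ Cm.
have := cone_dot_ge0 (cone_int_sub Oe) Cp; have := cone_dot_ge0 (cone_int_sub Oe) Cm.
have := dot_ge0 u; rewrite !dotL (dotC y u).
set uu := dot u u; set yy := dot y y; set uy := dot u y; set eu := dot e u; set ey := dot e y.
move=> u0 h1 h2 h3 h4; have : uu + yy <= c * (eu ^+ 2 + ey ^+ 2) by nra.
have : ey ^+ 2 <= eu ^+ 2 by rewrite -subr_ge0 subr_sqr; nra.
move=> h5 h6; have : c * ey ^+ 2 <= c * eu ^+ 2 by rewrite ler_pM2l.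
nra.
Qed.

(** A ball around e lies in C, so its image lies in an order interval around e A, whose size
    [interval_bounded] controls. This is the source of all compactness for automorphisms. *)
Lemma posm_bounded : exists2 M, 0 < M &
  forall A, posm A -> forall i j, `|A i j| <= M * dot e (e *m A).
Proof.
have [c c0 cP] := interval_bounded; have [d d0 dP] := cone_int_ball_sub.
exists (Num.sqrt (c / d)); first by rewrite sqrtr_gt0 divr_gt0.
move=> A pA i j; set t := Num.sqrt d; have t2 : t ^+ 2 = d by rewrite sqr_sqrtr // ltW.
have [|Cp Cm] := dP (t *: delta_mx 0 i).
  by rewrite dotZl dotZr mulrA -expr2 t2 dot_delta mxE !eqxx mulr1.
have := cP (e *m A) (t *: delta_mx 0 i *m A); rewrite -mulmxDl -mulmxBl.
move=> /(_ (pA _ Cp) (pA _ Cm)).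
rewrite -scalemxAl -rowE dotZl dotZr mulrA -expr2 t2 mulrC -ler_pdivlMr // => h.
have eA : 0 <= dot e (e *m A) by apply: cone_dot_ge0; [|apply: pA]; exact: cone_int_sub.
have := le_trans (entry_dot _ j) h; rewrite mxE => h2.
rewrite -(ler_pXn2r (n := 2)) ?nnegrE // ?mulr_ge0 ?sqrtr_ge0 //.
by rewrite exprMn sqr_sqrtr ?divr_ge0 ?(ltW c0) ?(ltW d0) // mulrAC.
Qed.

Lemma posm_cvg (A : nat -> 'M[R]_n.+1) M : (\forall k \near U, posm (A k)) ->
  (\forall k \near U, dot e (e *m A k) <= M) -> exists B, mcvg U A B.
Proof.
move=> pA AM; have [c c0 cP] := posm_bounded.
apply: (@mcvg_bounded _ _ UU _ _ _ (c * M)); apply: filterS2 pA AM => k pk kM i j.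
by apply: le_trans (cP _ pk i j) _; rewrite ler_pM2l.
Qed.

End OrderUnit.
Hypothesis Chom : forall x y, cone_int x -> cone_int y -> exists2 g, aut g & x *m g = y.

(** Maximise |det| over the families in C whose x0-heights are at most 1. Multilinearity of the
    determinant extends the bound to all families in C; applied to the maximiser itself, it forces
    every height to be 1. *)
Lemma vol_max x0 : cone_int x0 -> exists Y : 'M[R]_n.+1, [/\ Y \in unitmx, forall i, C (row i Y),
  forall i, dot x0 (row i Y) = 1 & forall Z : 'M[R]_n.+1, (forall i, C (row i Z)) ->
    `|\det Z| <= `|\det Y| * \prod_i dot x0 (row i Z)].
Proof.
move=> Ox.
pose S : set R := [set v | exists Y : 'M[R]_n.+1, [/\ forall i, C (row i Y),
  forall i, dot x0 (row i Y) <= 1 & v = `|\det Y| ]].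
have [c c0 cP] := cone_int_coercive Ox.
have ent Y : (forall i, C (row i Y)) -> (forall i, dot x0 (row i Y) <= 1) ->
    forall i j, `|Y i j| <= c + 1.
  move=> CY Y1 i j; have := cP _ (CY i); have := Y1 i; have := cone_dot_ge0 (cone_int_sub Ox) (CY i).
  have := entry_dot (row i Y) j; rewrite mxE; have := normr_ge0 (Y i j).
  set a := `|_|; set b := dot x0 _; set d := dot _ _ => a0 ad b0 b1 dc.
  have : c * b ^+ 2 <= c * 1 by rewrite ler_pM2l //; nra.
  by move=> cb; rewrite leNgt; apply/negP => ?; nra.
have supS : has_sup S.
  split.
    exists `|\det (0 : 'M[R]_n.+1)|, 0; split => // i; rewrite row0 ?dot0r //; exact: cone0.
  have [M MP] := det_bounded n (c + 1); exists M => _ [Y [CY Y1 ->]].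
  by apply: MP; exact: ent.
have [v vS vl] := sup_attained freeU supS.
have /choice[Y YP] := vS.
have [B YB] : exists B, mcvg U Y B.
  apply: (@mcvg_bounded _ _ UU _ _ _ (c + 1)); apply: nearW => k i j.
  by apply: ent; case: (YP k).
have vB : sup S = `|\det B|.
  apply: cvg_uniq vl _.
  have -> : v = fun k => `|\det (Y k)| by apply/funext => k; case: (YP k).
  by apply: cvg_norm; exact: cvg_det.
have rowB i : mcvg U (fun k => row i (Y k)) (row i B).
  by move=> a j; rewrite mxE; under eq_fun do rewrite mxE; exact: YB.
have CB i : C (row i B) by apply: cone_lim (rowB i) _; apply: nearW => k; case: (YP k).
have B1 i : dot x0 (row i B) <= 1.
  apply: (cvg_le_near UU (cvg_dot UU (mcvg_cst UU x0) (rowB i))).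
  by apply: nearW => k; case: (YP k).
have maxB Z : (forall i, C (row i Z)) -> `|\det Z| <= `|\det B| * \prod_i dot x0 (row i Z).
  move=> CZ'; have [[i zi]|no] := pselect (exists i, row i Z = 0).
    rewrite (det_row_eq0 zi) normr0 mulr_ge0 //; apply: prodr_ge0 => j _.
    by apply: cone_dot_ge0 => //; exact: cone_int_sub.
  have p0 i : 0 < dot x0 (row i Z) by apply: Ox => //; apply/eqP => zi; apply: no; exists i.
  pose d : 'rV[R]_n.+1 := \row_i (dot x0 (row i Z))^-1.
  have rowd i : row i (diag_mx d *m Z) = (dot x0 (row i Z))^-1 *: row i Z.
    by rewrite row_mul row_diag_mx -scalemxAl -rowE mxE.
  have : `|\det (diag_mx d *m Z)| <= sup S.
    apply: ub_le_sup; first exact: supS.2.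
    exists (diag_mx d *m Z); split => // i; rewrite rowd.
      by apply: coneZ => //; rewrite invr_ge0 ltW.
    by rewrite dotZr mulVf // gt_eqF.
  rewrite det_mulmx det_diag normrM normr_prod vB.
  under eq_bigr => i _ do rewrite mxE ger0_norm ?invr_ge0 ?(ltW (p0 i)) //.
  by rewrite prodfV ler_pdivrMl ?(mulrC `|\det B|) // prodr_gt0.
have uB : B \in unitmx.
  rewrite unitmxE unitfE -normr_gt0 lt_def normr_ge0 andbT; apply/eqP => B0.
  have [B' uB' CB'] := Cspan; have := maxB B' CB'; rewrite B0 mul0r normr_le0.
  by move: uB'; rewrite unitmxE unitfE => /negP.
exists B; split => // i.
have := maxB B CB; rewrite ler_pMr; last by move: uB; rewrite unitmxE unitfE normr_gt0.
have ge0 j : 0 <= dot x0 (row j B) by apply: cone_dot_ge0 => //; exact: cone_int_sub.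
rewrite (bigD1 i) //= => prod1; apply: le_anti; rewrite B1 /=.
apply: le_trans prod1 _; rewrite -[leRHS]mulr1; apply: ler_wpM2l => //.
by apply: prodr_ile1 => j; rewrite ge0 B1.
Qed.

(* For [h] automorphism, [|det h|] is a minimum over bases [Y] in [C] of products
   of the linear forms [dot (x0 *m h) y_i], up to a constant; this makes
   [x0 *m h |-> |det h|] log-concave and replaces the characteristic function
   [int_C exp(- dot x y) dy] of the cone. *)
Lemma vol_compare x0 : cone_int x0 -> exists2 Y0 : 'M[R]_n.+1, Y0 \in unitmx &
  forall h, aut h -> [/\ forall i, C (row i (Y0 *m invmx h^T)),
    forall i, dot (x0 *m h) (row i (Y0 *m invmx h^T)) = 1 &
    forall g, aut g -> `|\det g| <= `|\det h| * \prod_i dot (x0 *m g) (row i (Y0 *m invmx h^T))].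
Proof.
move=> Ox; have [Y [uY CY Y1 maxY]] := vol_max Ox; exists Y => // h ah.
have uh := aut_unit ah; have uht : h^T \in unitmx by rewrite unitmx_tr.
have CYh i : C (row i (Y *m invmx h^T)).
  by rewrite row_mul; apply: (aut_pos (aut_inv (aut_tr ah))).
split=> [//|i|g ag].
  by rewrite row_mul dot_mulr -mulmxA mulVmx // mulmx1.
have := maxY (Y *m invmx h^T *m g^T).
have -> : \prod_i dot x0 (row i (Y *m invmx h^T *m g^T)) =
    \prod_i dot (x0 *m g) (row i (Y *m invmx h^T)).
  by apply: eq_bigr => i _; rewrite row_mul dot_mulr.
rewrite !det_mulmx det_inv !det_tr !normrM normfV => le.
have dY : 0 < `|\det Y| by move: uY; rewrite unitmxE unitfE normr_gt0.
have dh : 0 < `|\det h| by move: uh; rewrite unitmxE unitfE normr_gt0.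
rewrite -(ler_pM2l dY) mulrCA -ler_pdivrMl // mulrA (mulrC _^-1); apply: le => i.
by rewrite row_mul; apply: (aut_pos (aut_tr ag)).
Qed.

Lemma det_gt0 g : aut g -> 0 < `|\det g|.
Proof. by move=> /aut_unit; rewrite unitmxE unitfE normr_gt0. Qed.

(** A minimising sequence of automorphisms is bounded by [posm_bounded], and |det| >= 1 passes to
    the limit, which is therefore invertible. *)
Lemma min_norm_ex : exists2 e, cone_int e &
  forall g, aut g -> 1 <= `|\det g| -> dot e e <= dot (e *m g) (e *m g).
Proof.
have [x0 Ox] := cone_int_ex.
pose S : set R := [set v | exists g, [/\ aut g, 1 <= `|\det g| & v = - dot (x0 *m g) (x0 *m g)]].
have supS : has_sup S.
  split; last by exists 0 => _ [g [_ _ ->]]; rewrite oppr_le0 dot_ge0.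
  by exists (- dot (x0 *m 1%:M) (x0 *m 1%:M)), 1%:M; rewrite det1 normr1; split => //; exact: aut1.
have [v vS vl] := sup_attained freeU supS; have /choice[g gP] := vS.
have [h gh] : exists h, mcvg U g h.
  apply: (posm_cvg Ox (M := dot x0 x0 + 1 - sup S)).
    by apply: nearW => k; case: (gP k) => -[].
  have : sup S - 1 < sup S by lra.
  move=> /(cvg_gt_near UU vl); apply: filterS => k; case: (gP k) => _ _ -> vk.
  have := dot_ge0 (x0 - x0 *m g k); rewrite !dotL (dotC (x0 *m g k) x0).
  have := dot_ge0 (x0 *m g k); have := dot_ge0 x0.
  move: vk; set a := dot x0 x0; set b := dot x0 _; set d := dot _ _ ; lra.
have dh : 1 <= `|\det h|.
  apply: (cvg_ge_near UU (cvg_norm (cvg_det UU gh))).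
  by apply: nearW => k; case: (gP k).
have ah : aut h.
  apply: (aut_lim gh); last by apply: nearW => k; case: (gP k).
  by rewrite unitmxE unitfE -normr_gt0 (lt_le_trans ltr01).
have vh : sup S = - dot (x0 *m h) (x0 *m h).
  apply: cvg_uniq vl _.
  have -> : v = fun k => - dot (x0 *m g k) (x0 *m g k) by apply/funext => k; case: (gP k).
  have xg := mcvgM UU (mcvg_cst UU x0) gh.
  by apply: cvgN; exact: (cvg_dot UU xg xg).
exists (x0 *m h) => [|k ak dk]; first exact: cone_int_aut.
rewrite -lerN2 -vh; apply: ub_le_sup; first exact: supS.2.
exists (h *m k); rewrite mulmxA; split => //; first exact: autM.
by rewrite det_mulmx normrM mulr_ege1.
Qed.

(* The point of least norm in the convex set [|det g| >= 1] also minimises the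
   linear form [dot _ e] there. *)
Lemma center_ex : exists2 e, cone_int e &
  forall g, aut g -> 1 <= `|\det g| -> dot e e <= dot (e *m g) e.
Proof.
have [e Oe emin] := min_norm_ex; exists e => // g ag dg.
have [Y uY YP] := vol_compare Oe.
have key t : 0 < t -> t <= 1 ->
    0 <= t * (2 * dot (e *m g - e) e + t * dot (e *m g - e) (e *m g - e)).
  move=> t0 t1; have Oet : cone_int ((1 - t) *: e + t *: (e *m g)).
    have [->|t1'] := eqVneq t 1; first by rewrite subrr scale0r add0r scale1r; exact: cone_int_aut.
    apply: cone_intD; first by apply: cone_intZ => //; rewrite subr_gt0 lt_neqAle t1'.
    by apply: coneZ; [exact: ltW|apply: cone_int_sub; exact: cone_int_aut].
  have [h ah eh] := Chom Oe Oet; have [CYh Yh1 cmp] := YP h ah.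
  (* Log-concavity: were |det h| < 1, the products of the heights a_i of e and b_i of e g would both
     exceed 1, so the sums of a_i - 1 and of b_i - 1 would be positive. Their combination with
     weights 1 - t and t is 0, because all heights of e h are 1. *)
  have dh1 : 1 <= `|\det h|.
    rewrite leNgt; apply/negP => dh.
    pose a i := dot e (row i (Y *m invmx h^T)); pose b i := dot (e *m g) (row i (Y *m invmx h^T)).
    have a0 i : 0 <= a i by apply: cone_dot_ge0 => //; exact: cone_int_sub.
    have b0 i : 0 <= b i by apply: cone_dot_ge0 => //; apply/cone_int_sub/cone_int_aut.
    have := cmp _ ag; have := cmp _ aut1; rewrite mulmx1 det1 normr1 -/(a _).
    have := prod_le_expR a0; have := prod_le_expR b0.
    rewrite -/(\prod_i a i) -/(\prod_i b i).
    set pa := \prod_i a i; set pb := \prod_i b i => hb ha ca cb.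
    have dh0 := det_gt0 ah.
    have pa1 : 1 < pa by rewrite ltNge; apply/negP => ?; nra.
    have pb1 : 1 < pb by rewrite ltNge; apply/negP => ?; nra.
    have sa : 0 < \sum_i (a i - 1).
      by rewrite -expR_gt1; exact: lt_le_trans pa1 ha.
    have sb : 0 < \sum_i (b i - 1).
      by rewrite -expR_gt1; exact: lt_le_trans pb1 hb.
    have : (1 - t) * \sum_i (a i - 1) + t * \sum_i (b i - 1) = 0.
      rewrite !mulr_sumr -big_split /=; apply: big1 => i _.
      have := Yh1 i; rewrite eh dotDl !dotZl -/(a i) -/(b i) => h1.
      by rewrite !mulrBr addrACA h1; ring.
    nra.
  have := emin h ah dh1; rewrite eh.
  have -> : (1 - t) *: e + t *: (e *m g) = e + t *: (e *m g - e).
    by rewrite scalerBl scale1r scalerBr addrAC addrA.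
  move: (e *m g - e) => w; rewrite !dotL (dotC e w); set ee := dot e e => ?; lra.
rewrite -subr_ge0 -dotBl leNgt; apply/negP => d0.
set d := dot (e *m g - e) e in key d0; set q := dot (e *m g - e) _ in key.
have q0 : 0 <= q by exact: dot_ge0.
have qd : 0 < q - d by lra.
(* This t lies in (0, 1] and satisfies t q <= -d, so 2d + t q <= d < 0. *)
have := key (- d / (q - d)); rewrite divr_gt0 ?oppr_gt0 // ler_pdivrMr // mul1r => /(_ isT).
have -> : - d <= q - d by lra.
move=> /(_ isT); rewrite pmulr_rge0 ?divr_gt0 ?oppr_gt0 // leNgt => /negP; apply.
have : - d / (q - d) * q <= - d by rewrite mulrAC ler_pdivrMr //; nra.
lra.
Qed.

(** * Inequalities at the central point *)

Section Center.
Variable e : 'rV[R]_n.+1.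
Hypothesis Oe : cone_int e.
Hypothesis ecen : forall g, aut g -> 1 <= `|\det g| -> dot e e <= dot (e *m g) e.

Lemma ee_gt0 : 0 < dot e e.
Proof. by rewrite dot_gt0 cone_int_neq0. Qed.

Lemma dot_aut_gt0 g : aut g -> 0 < dot (e *m g) e.
Proof. by move=> ag; rewrite dotC; apply: Oe; [apply: cone_int_sub|apply: cone_int_neq0]; exact: cone_int_aut. Qed.

(* [dot (e g) e >= dot e e * |det g|^(1/N)] for the pair [g], [h], with the root
   hidden in a rescaling. *)
Lemma center_prod g h : aut g -> aut h -> 1 <= `|\det g| * `|\det h| ->
  dot e e ^+ 2 <= dot (e *m g) e * dot (e *m h) e.
Proof.
move=> ag ah dgh; have r0 := ee_gt0.
have s0 := dot_aut_gt0 ag; have t0 := dot_aut_gt0 ah.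
set r := dot e e in r0 *; set s := dot _ _ in s0 *; set t := dot _ _ in t0 *.
rewrite leNgt; apply/negP => st.
(* If s t < r^2, this a lies strictly between t/r and r/s, so a g and a^-1 h both send e to a point
   whose product with e is below r. Their determinants multiply to at least 1 in absolute value, so
   one of them violates [ecen]. *)
pose a := (t / r + r / s) / 2.
have tr : t / r < r / s by rewrite ltr_pdivrMr // mulrAC ltr_pdivlMr // -expr2 mulrC.
have a0 : 0 < a by rewrite divr_gt0 ?addr_gt0 ?divr_gt0.
have as_ : a * s < r by rewrite -ltr_pdivlMr // /a; lra.
have at_ : t < a * r by rewrite -ltr_pdivrMr // /a; lra.
have aa := aut_scalar a0; have aai : aut (a^-1)%:M by apply: aut_scalar; rewrite invr_gt0.
have [d1|d1] := leP 1 `|\det (a%:M *m g)|.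
  have := ecen (autM aa ag) d1; rewrite mulmxA mul_mx_scalar -scalemxAl dotZl -/s -/r; lra.
have d2 : 1 <= `|\det ((a^-1)%:M *m h)|.
  have e1 : \det (a%:M : 'M[R]_n.+1) * \det (a^-1%:M : 'M[R]_n.+1) = 1.
    by rewrite -det_mulmx -scalar_mxM mulfV ?det1 // gt_eqF.
  have : `|\det g| * `|\det h| = `|\det (a%:M *m g)| * `|\det ((a^-1)%:M *m h)|.
    rewrite -!normrM -!det_mulmx; congr `| _ |.
    by rewrite !det_mulmx [RHS]mulrACA e1 mul1r.
  move=> dd; rewrite dd in dgh; move: dgh d1; have := normr_ge0 (\det (a%:M *m g)).
  have := normr_ge0 (\det ((a^-1)%:M *m h)).
  set x := `| _ |; set y := `| _ | => *; nra.
have := ecen (autM aai ah) d2; rewrite mulmxA mul_mx_scalar -scalemxAl dotZl -/t -/r.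
rewrite mulrC ler_pdivlMr //; lra.
Qed.

(** Strong log-concavity of |det| at the midpoint. In the basis adapted to h the heights of e g and
    e are 1 + a_i and 1 - a_i; the product of the 1 - a_i^2 is at most the exponential of minus the
    sum of the a_i^2, and this sum dominates |e g - e|^2 because h is bounded. *)
Lemma midpoint_bound : exists2 c, 0 < c & forall g, aut g -> dot (e *m g) e <= 2 * dot e e ->
  exists2 h, aut h & dot (e *m h) e = (dot (e *m g) e + dot e e) / 2 /\
    `|\det g| <= `|\det h| ^+ 2 * expR (- (c * dot (e *m g - e) (e *m g - e))).
Proof.
have [Y uY YP] := vol_compare Oe.
have [M M0 MP] := posm_bounded Oe.
have [K K0 KP] := mulmx_norm_bounded n.+1 (M * (2 * dot e e)).
have [L mulop0 LP] : exists2 L, 0 < L & forall v, dot (v *m invmx Y^T) (v *m invmx Y^T) <= L * dot v v.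
  have [L mulop0 LP] := mulmx_norm_bounded n.+1 (\sum_i \sum_j `|(invmx Y^T) i j|).
  exists L => // v; apply: LP => i j; rewrite (bigD1 i) //= (bigD1 j) //= -addrA lerDl.
  by rewrite addr_ge0 ?sumr_ge0 // => k _; rewrite ?sumr_ge0.
exists (4 * K * L)^-1 => [|g ag g2]; first by rewrite invr_gt0 !mulr_gt0.
set x := e *m g in g2 *.
have Ox : cone_int x by exact: cone_int_aut.
have Om2 : cone_int (2^-1 *: (x + e)) by apply: cone_intZ; rewrite ?invr_gt0 //; apply: cone_intD => //; exact: cone_int_sub.
have [h ah eh] := Chom Oe Om2; exists h => //.
have mE : dot (e *m h) e = (dot x e + dot e e) / 2 by rewrite eh dotZl dotDl mulrC.
split=> //; have [CYh Yh1 cmp] := YP h ah.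
pose a i := 2^-1 * dot (x - e) (row i (Y *m invmx h^T)).
have xa i : dot x (row i (Y *m invmx h^T)) = 1 + a i.
  by have := Yh1 i; rewrite eh dotZl dotDl /a dotBl; set u := dot x _; set v := dot e _; lra.
have ea i : dot e (row i (Y *m invmx h^T)) = 1 - a i.
  by have := Yh1 i; rewrite eh dotZl dotDl /a dotBl; set u := dot x _; set v := dot e _; lra.
have xa0 i : 0 <= 1 + a i by rewrite -xa; apply: cone_dot_ge0 => //; exact: cone_int_sub.
have ea0 i : 0 <= 1 - a i by rewrite -ea; apply: cone_dot_ge0 => //; exact: cone_int_sub.
have := cmp _ ag; have := cmp _ aut1; rewrite mulmx1 det1 normr1.
under eq_bigr do rewrite ea.
rewrite -/x; under [X in _ -> _ <= _ * X -> _]eq_bigr do rewrite xa.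
set pe := \prod_i (1 - a i); set px := \prod_i (1 + a i) => h1 h2.
have dh := det_gt0 ah.
have px0 : 0 <= px by apply: prodr_ge0.
have pp : px * pe <= expR (- \sum_i a i ^+ 2).
  rewrite -big_split /= -sumrN expR_sum; apply: ler_prod => i _.
  rewrite mulr_ge0 //=; have := expR_ge1Dx (- a i ^+ 2); lra.
apply: (@le_trans _ _ (`|\det h| ^+ 2 * (px * pe))).
  have : 0 <= `|\det h| * px by rewrite mulr_ge0.
  rewrite expr2 mulrACA; nra.
rewrite ler_wpM2l ?sqr_ge0 //; apply: le_trans pp _; rewrite ler_expR lerN2.
rewrite ler_pdivrMl ?mulr_gt0 //.
pose av := \row_i a i.
have avE : av = 2^-1 *: ((x - e) *m invmx h *m Y^T).
  apply/rowP => i; rewrite mxE [RHS]mxE; congr (_ * _).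
  rewrite row_mul -trmx_inv -dot_mulr dotE [RHS]mxE.
  by apply: eq_bigr => j _; rewrite !mxE.
have uh := aut_unit ah.
have xeE : x - e = 2 *: (av *m invmx Y^T) *m h.
  rewrite avE -!scalemxAl scalerA mulfV ?pnatr_eq0 // scale1r mulmxK ?unitmx_tr //.
  by rewrite -mulmxA mulVmx // mulmx1.
rewrite [in leLHS]xeE; apply: le_trans (KP h _ _) _.
  move=> i j; apply: le_trans (MP h (aut_pos ah) i j) _.
  by rewrite ler_pM2l // dotC mE; have := ee_gt0; lra.
rewrite dotZl dotZr.
have -> : \sum_i a i ^+ 2 = dot av av by rewrite dotE; apply: eq_bigr => i _; rewrite mxE expr2.
have := LP av; set u := dot _ _; set v := dot _ _ => uv.
have : K * u <= K * (L * v) by rewrite ler_pM2l.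
lra.
Qed.

(* [z] is the inverse of [x] in the Jordan algebra to come. Since
   [dot (x - e) (z - e) = 2 dot e e - dot x e - dot z e], the bound says that
   inversion is strictly decreasing and Lipschitz at [e]. *)
Lemma inverse_strong : exists2 c, 0 < c & forall g, aut g ->
  let x := e *m g in let z := e *m invmx g^T in
  dot x e <= 2 * dot e e -> dot z e <= 2 * dot e e ->
  c * (dot (x - e) (x - e) + dot (z - e) (z - e)) <= dot x e + dot z e - 2 * dot e e.
Proof.
have [c c0 cP] := midpoint_bound; have r0 := ee_gt0.
exists (c * dot e e / (5 * n.+1%:R)).
  by rewrite divr_gt0 // mulr_gt0.
move=> g ag x z x2 z2.
have agi : aut (invmx g^T) by exact/aut_inv/aut_tr.
have [h ah [hE hd]] := cP _ ag x2.
have [k ak [kE kd]] := cP _ agi z2.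
rewrite -/x -/z in hE hd kE kd *.
set A := dot (x - e) (x - e) in hd *; set B := dot (z - e) (z - e) in kd *.
pose D := c * (A + B).
have D0 : 0 <= D by rewrite mulr_ge0 ?addr_ge0 ?dot_ge0 // ltW.
have dh := det_gt0 ah; have dk := det_gt0 ak; have dg := det_gt0 ag.
have hk : expR (D / 2) <= `|\det h| * `|\det k|.
  rewrite -(ler_pXn2r (n := 2)) ?nnegrE ?expR_ge0 ?mulr_ge0 //.
  rewrite expr2 -expRD -splitr exprMn.
  rewrite -[leLHS]mul1r -ler_pdivlMr ?expR_gt0 // -expRN.
  have -> : 1 = `|\det g| * `|\det (invmx g^T)|.
    by rewrite det_inv det_tr normfV mulfV // gt_eqF.
  apply: le_trans (ler_pM _ _ hd kd) _; rewrite ?normr_ge0 //.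
  rewrite mulrACA -expRD /D le_eqVlt; apply/orP; left; apply/eqP; congr (_ * expR _); ring.
have [N N0 NE] : exists2 N : R, 0 < N & n.+1%:R = N by exists n.+1%:R.
(* Scaling h by this factor multiplies its determinant by exp(-D/2), which uses up exactly the
   surplus in [hk]; [center_prod] then gains the factor exp(D/(2N)) >= 1 + D/(2N). *)
pose a := expR (- (D / (2 * N))).
have ah' := autM (aut_scalar (expR_gt0 (- (D / (2 * N))))) ah.
have := center_prod ah' ak; rewrite mulmxA mul_mx_scalar -scalemxAl dotZl det_mulmx det_scalar.
rewrite normrM normrX (ger0_norm (expR_ge0 _)) -expRM_natl.
have -> : n.+1%:R * - (D / (2 * N)) = - (D / 2).
  by rewrite NE; field; rewrite gt_eqF.
have hk1 : 1 <= expR (- (D / 2)) * `|\det h| * `|\det k|.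
  by rewrite -mulrA expRN ler_pdivlMl ?expR_gt0 // mulr1.
move=> /(_ hk1); rewrite -mulrA expRN ler_pdivlMl ?expR_gt0 //.
have := expR_ge1Dx (D / (2 * N)); rewrite hE kE => h1 h2.
set r := dot e e in r0 x2 z2 h2 *; set s := dot x e in x2 h2 *; set t := dot z e in z2 h2 *.
have s0 : 0 < s by exact: dot_aut_gt0.
have t0 : 0 < t by exact: dot_aut_gt0.
pose E := D / (2 * N); have E0 : 0 <= E by rewrite divr_ge0 // mulr_ge0 // ltW.
have h3 : (1 + E) * r ^+ 2 <= (s + r) / 2 * ((t + r) / 2).
  by apply: le_trans h2; rewrite ler_wpM2r // sqr_ge0.
have -> : c * r / (5 * n.+1%:R) * (A + B) = 2 / 5 * r * E.
  by rewrite /E /D NE; field; rewrite gt_eqF.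
exact: strong_arith r0 s0 t0 x2 z2 E0 h3.
Qed.

Lemma dot_inv g : aut g -> dot (e *m g) (e *m invmx g^T) = dot e e.
Proof. by move=> /aut_unit ug; rewrite dot_mulr -mulmxA mulVmx ?mulmx1 ?unitmx_tr. Qed.

(** All powers of h are positive and fix e, so [posm_bounded] bounds them uniformly, and with them
    the powers of l. *)
Lemma pos_fix_eig h x l : posm h -> e *m h = e -> x != 0 -> x *m h = l *: x -> 0 <= l -> l <= 1.
Proof.
move=> ph eh x0 xh l0; have [M M0 MP] := posm_bounded Oe.
have iterE m : posm (h ^+ m) /\ e *m h ^+ m = e.
  elim: m => [|m [IH1 IH2]]; first by rewrite expr0 mulmx1; split=> // y; rewrite mulmx1.
  by rewrite exprS -mulmxE mulmxA eh IH2; split => //; exact: posmM.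
have xm m : x *m h ^+ m = l ^+ m *: x.
  elim: m => [|m IH]; first by rewrite expr0 mulmx1 scale1r.
  by rewrite exprS -mulmxE mulmxA xh -scalemxAl IH scalerA -exprS.
have [K K0 KP] := mulmx_norm_bounded n.+1 (M * dot e e).
suff : l ^+ 2 <= 1 by rewrite expr_le1.
apply: (@expr_bounded _ _ K) => m; have := KP (h ^+ m) _ x.
rewrite xm dotZl dotZr mulrA -expr2 -exprM mulnC exprM ler_pM2r ?dot_gt0 //; apply=> i j.
by have [pm em] := iterE m; have := MP _ pm i j; rewrite em.
Qed.

(** In [inverse_strong] for k^T the right side is 0, so k^T fixes e too. Then k k^T and its inverse
    are positive maps fixing e, so the eigenvalues of k k^T and their inverses are at most 1. *)
Lemma stab_orth k : aut k -> e *m k = e -> k *m k^T = 1%:M.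
Proof.
move=> ak ek; have r0 := ee_gt0.
have ekT : e *m k^T = e.
  have [c c0 cP] := inverse_strong; have := cP _ (aut_tr ak) => /=.
  have uk := aut_unit ak.
  have eki : e *m invmx k = e by rewrite -{1}ek mulmxK.
  rewrite trmxK eki dot_mulr trmxK ek subrr dot0l addr0.
  have -> : dot e e + dot e e - 2 * dot e e = 0 by ring.
  have rr : dot e e <= 2 * dot e e by lra.
  move=> /(_ rr rr); rewrite pmulr_rle0 // => h; apply/eqP; rewrite -subr_eq0 -dot_eq0.
  by apply/eqP/le_anti; rewrite h dot_ge0.
pose h := k *m k^T; have ah : aut h by apply: autM => //; exact: aut_tr.
have eh : e *m h = e by rewrite mulmxA ek.
have sh : h^T = h by rewrite trmx_mul trmxK.
apply/eqP; rewrite -subr_eq0; apply/eqP; rewrite -/h.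
apply: sym_eq0; first by rewrite linearB /= sh tr_scalar_mx.
move=> l x x0; rewrite mulmxBr mulmx1 => /eqP; rewrite subr_eq -[X in _ == _ + X]scale1r -scalerDl => /eqP xh.
have l1 : 0 <= l + 1.
  have : 0 <= (l + 1) * dot x x by rewrite -dotZl -xh mulmxA dot_mulr trmxK dot_ge0.
  by rewrite pmulr_lge0 ?dot_gt0.
have lne : l + 1 != 0.
  apply: contra_neq x0 => l10; have uh := aut_unit ah.
  by rewrite -(mulmxK uh x) xh l10 scale0r mul0mx.
have le1 := pos_fix_eig (aut_pos ah) eh x0 xh l1.
have ge1 : (l + 1)^-1 <= 1.
  apply: (@pos_fix_eig (invmx h) x); rewrite ?invr_ge0 //.
  - exact: aut_pos (aut_inv ah).
  - by rewrite -{1}eh mulmxK // aut_unit.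
  - have xi : x = (l + 1) *: (x *m invmx h) by rewrite scalemxAl -xh mulmxK ?aut_unit.
    by rewrite [in RHS]xi scalerA mulVf // scale1r.
have l0 : 0 < l + 1 by rewrite lt_def lne.
move: ge1; rewrite invf_le1 //; lra.
Qed.

(* The Lie algebra of the automorphism group, in a form that is visibly linear
   and needs no exponential. *)
Definition lie_aut (X : 'M[R]_n.+1) :=
  forall x y, C x -> C y -> dot x y = 0 -> dot (x *m X) y = 0.

(* Tangent vectors at [1] to the automorphism group. They lie in [lie_aut], and
   brackets with them stay in [lie_aut] because they are limits of group elements. *)
Definition tang (X : 'M[R]_n.+1) := exists (g : nat -> 'M[R]_n.+1) (d : nat -> R),
  [/\ \forall k \near U, aut (g k) /\ 0 < d k, d @ U --> (0 : R),
      mcvg U (fun k => (d k)^-1 *: (g k - 1%:M)) X &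
      mcvg U (fun k => (d k)^-1 *: (invmx (g k) - 1%:M)) (- X)].

(** * The Lie algebra and tangent vectors *)

Lemma lie_autD X Y : lie_aut X -> lie_aut Y -> lie_aut (X + Y).
Proof. by move=> LX LY x y Cx Cy xy; rewrite mulmxDr dotDl LX ?LY ?addr0. Qed.

Lemma lie_autZ a X : lie_aut X -> lie_aut (a *: X).
Proof. by move=> LX x y Cx Cy xy; rewrite -scalemxAr dotZl LX ?mulr0. Qed.

Lemma lie_aut1 : lie_aut 1%:M.
Proof. by move=> x y _ _ xy; rewrite mulmx1. Qed.

Lemma lie_aut_lim (X : nat -> 'M[R]_n.+1) Y :
  mcvg U X Y -> (\forall k \near U, lie_aut (X k)) -> lie_aut Y.
Proof.
move=> XY LX x y Cx Cy xy.
apply: (cvg_near_cst UU (cvg_dot UU (mcvgM UU (mcvg_cst UU x) XY) (mcvg_cst UU y))).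
by apply: filterS LX => k Lk; rewrite Lk.
Qed.

(** For orthogonal x and y in C, both dot (x g) y and dot (x g^-1) y are nonnegative, and their
    first-order terms are opposite. *)
Lemma tang_lie X : tang X -> lie_aut X.
Proof.
move=> [g [d [agd d0 gX giX]]] x y Cx Cy xy; apply: le_anti; apply/andP; split.
  rewrite -oppr_ge0 -dotNl -mulmxN.
  apply: (cvg_ge_near UU (cvg_dot UU (mcvgM UU (mcvg_cst UU x) giX) (mcvg_cst UU y))).
  apply: filterS agd => k [[_ _ pk] dk].
  rewrite -scalemxAr mulmxBr mulmx1 dotZl dotBl xy subr0 mulr_ge0 ?invr_ge0 ?(ltW dk) //.
  by apply: cone_dot_ge0 => //; exact: pk.
apply: (cvg_ge_near UU (cvg_dot UU (mcvgM UU (mcvg_cst UU x) gX) (mcvg_cst UU y))).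
apply: filterS agd => k [[_ pk _] dk].
rewrite -scalemxAr mulmxBr mulmx1 dotZl dotBl xy subr0 mulr_ge0 ?invr_ge0 ?(ltW dk) //.
by apply: cone_dot_ge0 => //; exact: pk.
Qed.

Lemma tang_intro (g : nat -> 'M[R]_n.+1) (d : nat -> R) X :
  (\forall k \near U, aut (g k) /\ 0 < d k) -> d @ U --> (0 : R) -> mcvg U g 1%:M ->
  mcvg U (fun k => (d k)^-1 *: (g k - 1%:M)) X -> tang X.
Proof.
move=> agd d0 g1 gX; exists g, d; split=> //.
have gi1 : mcvg U (fun k => invmx (g k)) 1%:M by rewrite -(@invmx1 R n.+1); apply: mcvg_inv g1 (unitmx1 _ _).
have := mcvgN UU (mcvgM UU gi1 gX); rewrite mul1mx; apply: mcvg_near => //.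
apply: filterS agd => k [[ug _ _] dk].
by rewrite -scalemxAr -scalerN mulmxBr mulVmx // mulmx1 opprB.
Qed.

Lemma diff_cvg0 (g : nat -> 'M[R]_n.+1) (d : nat -> R) X :
  (\forall k \near U, 0 < d k) -> d @ U --> (0 : R) ->
  mcvg U (fun k => (d k)^-1 *: (g k - 1%:M)) X -> mcvg U g 1%:M.
Proof.
move=> dpos d0 gX; have := mcvgD UU (mcvgZ UU d0 gX) (mcvg_cst UU 1%:M).
rewrite scale0r add0r; apply: mcvg_near => //; apply: filterS dpos => k dk.
by rewrite scalerA mulfV ?gt_eqF // scale1r subrK.
Qed.

Lemma mcvg_conj (g : nat -> 'M[R]_n.+1) (d : nat -> R) X Y :
  (\forall k \near U, aut (g k) /\ 0 < d k) -> d @ U --> (0 : R) ->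
  mcvg U (fun k => (d k)^-1 *: (g k - 1%:M)) X ->
  mcvg U (fun k => (d k)^-1 *: (invmx (g k) - 1%:M)) (- X) ->
  mcvg U (fun k => (d k)^-1 *: (g k *m Y *m invmx (g k) - Y)) (X *m Y - Y *m X).
Proof.
move=> agd d0 gX giX.
have gi1 : mcvg U (fun k => invmx (g k)) 1%:M.
  by apply: (diff_cvg0 _ d0 giX); apply: filterS agd => k [].
have := mcvgD UU (mcvgM UU (mcvgM UU gX (mcvg_cst UU Y)) gi1) (mcvgM UU (mcvg_cst UU Y) giX).
rewrite mulmx1 mulmxN; apply: mcvg_near => //; apply: nearW => k.
rewrite -!scalemxAl -scalemxAr -scalerDr; congr (_ *: _).
by rewrite !mulmxBl mul1mx mulmxBr mulmx1 addrA subrK.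
Qed.

Lemma tang_conj X h : tang X -> aut h -> tang (h *m X *m invmx h).
Proof.
move=> [g [d [agd d0 gX giX]]] ah; have uh := aut_unit ah.
have cj Y Z : mcvg U Y Z -> mcvg U (fun k => h *m Y k *m invmx h) (h *m Z *m invmx h).
  by move=> YZ; exact (mcvgM UU (mcvgM UU (mcvg_cst UU h) YZ) (mcvg_cst UU (invmx h))).
exists (fun k => h *m g k *m invmx h), d; split=> //.
- by apply: filterS agd => k [ag dk]; split=> //; apply: autM (aut_inv ah); exact: autM.
- have := cj _ _ gX; apply: mcvg_near => //; apply: nearW => k.
  by rewrite -scalemxAr -scalemxAl mulmxBr mulmxBl mulmx1 mulmxV.
- have := cj _ _ giX; rewrite mulmxN mulNmx; apply: mcvg_near => //; apply: filterS agd => k [ag dk].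
  have ug := aut_unit ag.
  rewrite -scalemxAr -scalemxAl mulmxBr mulmxBl mulmx1 mulmxV //.
  by rewrite !invmxM ?unitmx_mul ?unitmx_inv ?uh // invmxK mulmxA.
Qed.

Lemma lie_aut_conj X h : lie_aut X -> aut h -> lie_aut (h *m X *m invmx h).
Proof.
move=> LX ah x y Cx Cy xy; rewrite !mulmxA dot_mulr; apply: LX.
- exact: (aut_pos ah).
- by rewrite trmx_inv; apply: (aut_pos (aut_inv (aut_tr ah))).
- by rewrite dot_mulr trmx_inv mulmxKV // unitmx_tr aut_unit.
Qed.

Lemma tang_bracket X Y : tang X -> lie_aut Y -> lie_aut (X *m Y - Y *m X).
Proof.
move=> [g [d [agd d0 gX giX]]] LY; apply: (lie_aut_lim (mcvg_conj (Y := Y) agd d0 gX giX)).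
apply: filterS agd => k [ag _]; apply: lie_autZ; apply: lie_autD; first exact: lie_aut_conj.
by rewrite -scaleN1r; exact: lie_autZ.
Qed.

(* First-order expansion of [center_prod] at [h g h^-1] and [g^-1]. *)
Lemma tau_conj_ge X h : tang X -> aut h ->
  dot (e *m X) e <= dot (e *m (h *m X *m invmx h)) e.
Proof.
move=> tX ah; have uh := aut_unit ah; have r0 := ee_gt0.
have [g [d [agd d0 gX giX]]] := tX.
pose p k := dot (e *m (h *m ((d k)^-1 *: (g k - 1%:M)) *m invmx h)) e.
pose q k := dot (e *m ((d k)^-1 *: (invmx (g k) - 1%:M))) e.
have pl : p @ U --> dot (e *m (h *m X *m invmx h)) e.
  apply: cvg_dot (mcvg_cst UU e); apply: mcvgM (mcvg_cst UU e) _ => //.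
  by apply: mcvgM (mcvg_cst UU _) => //; exact: mcvgM (mcvg_cst UU h) gX.
have ql : q @ U --> dot (e *m - X) e.
  by apply: cvg_dot (mcvg_cst UU e); exact: mcvgM (mcvg_cst UU e) giX.
have pq : (fun k => dot e e * (p k + q k) + d k * (p k * q k)) @ U -->
    dot e e * (dot (e *m (h *m X *m invmx h)) e + dot (e *m - X) e) +
    0 * (dot (e *m (h *m X *m invmx h)) e * dot (e *m - X) e).
  apply: cvgD; first by apply: cvgM; [exact: cvg_cst|exact: cvgD].
  by apply: cvgM => //; exact: cvgM.
have : 0 <= dot e e * (dot (e *m (h *m X *m invmx h)) e + dot (e *m - X) e) +
    0 * (dot (e *m (h *m X *m invmx h)) e * dot (e *m - X) e).
  apply: (cvg_ge_near UU pq); apply: filterS agd => k [ag dk].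
  have ug := aut_unit ag; have aghg := autM (autM ah ag) (aut_inv ah).
  have := center_prod aghg (aut_inv ag).
  rewrite !det_mulmx !det_inv !normrM !normfV.
  have dh := det_gt0 ah; have dg := det_gt0 ag.
  have -> : `|\det h| * `|\det (g k)| / `|\det h| / `|\det (g k)| = 1.
    by field; rewrite !gt_eqF.
  move=> /(_ (lexx _)).
  have -> : dot (e *m (h *m g k *m invmx h)) e = dot e e + d k * p k.
    rewrite /p -scalemxAr -scalemxAl -scalemxAr dotZl mulrA mulfV ?gt_eqF // mul1r.
    by rewrite mulmxBr mulmxBl mulmx1 mulmxV // mulmxBr mulmx1 dotBl addrC subrK.
  have -> : dot (e *m invmx (g k)) e = dot e e + d k * q k.
    rewrite /q -scalemxAr dotZl mulrA mulfV ?gt_eqF // mul1r.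
    by rewrite mulmxBr mulmx1 dotBl addrC subrK.
  rewrite -subr_ge0 => h1; rewrite -(pmulr_rge0 _ dk).
  by apply: le_trans h1 _; rewrite le_eqVlt; apply/orP; left; apply/eqP; ring.
by rewrite mul0r addr0 pmulr_rge0 // mulmxN dotNl subr_ge0.
Qed.

(** The previous inequality for h and for its inverse: X |-> dot (e X) e behaves like a trace. *)
Lemma tau_conj X h : tang X -> aut h -> dot (e *m (h *m X *m invmx h)) e = dot (e *m X) e.
Proof.
move=> tX ah; apply: le_anti; rewrite tau_conj_ge // andbT.
have := tau_conj_ge (tang_conj tX ah) (aut_inv ah); rewrite invmxK !mulmxA.
have uh := aut_unit ah.
by rewrite -(mulmxA e (invmx h)) mulVmx // mulmx1 -(mulmxA _ (invmx h)) mulVmx // mulmx1.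
Qed.

Lemma tau_bracket X Y : tang X -> tang Y -> dot (e *m (X *m Y - Y *m X)) e = 0.
Proof.
move=> [g [d [agd d0 gX giX]]] tY.
have lim := mcvgM UU (mcvg_cst UU e) (mcvg_conj (Y := Y) agd d0 gX giX).
apply: (cvg_near_cst UU (cvg_dot UU lim (mcvg_cst UU e))); apply: filterS agd => k [ag _].
by rewrite -scalemxAr dotZl mulmxBr dotBl tau_conj // subrr mulr0.
Qed.

(** mu is the maximum of [dot x] on the slice dot e z = 1 of C, attained at z. In Jordan terms it is
    the largest spectral value of x. *)
Lemma max_face x : exists mu z, [/\ C z, z != 0, C (mu *: e - x) & dot (mu *: e - x) z = 0].
Proof.
have r0 := ee_gt0.
pose S : set R := [set v | exists z, [/\ C z, dot e z = 1 & v = dot x z]].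
have [c c0 cP] := cone_int_coercive Oe.
have supS : has_sup S.
  split.
    exists (dot x ((dot e e)^-1 *: e)), ((dot e e)^-1 *: e); split=> //.
      by apply: coneZ; [rewrite invr_ge0 ltW|exact: cone_int_sub].
    by rewrite dotZr mulVf // gt_eqF.
  exists (dot x x + c) => _ [z [Cz z1 ->]].
  have := cP z Cz; rewrite z1 expr1n mulr1 => zc.
  have := dot_ge0 (x - z); rewrite !dotL (dotC z x); have := dot_ge0 x; have := dot_ge0 z.
  set a := dot x x; set b := dot z z in zc *; set f := dot x z; lra.
have [v vS vl] := sup_attained freeU supS; have /choice[z zP] := vS.
have [w zw] : exists w, mcvg U z w.
  apply: (@mcvg_dot_bounded _ _ _ _ _ c); apply: nearW => k; case: (zP k) => Cz z1 _.
  by have := cP _ Cz; rewrite z1 expr1n mulr1.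
have Cw : C w by apply: cone_lim zw _; apply: nearW => k; case: (zP k).
have ew : dot e w = 1.
  apply: cvg_uniq (cvg_dot UU (mcvg_cst UU e) zw) _.
  have -> : (fun k => dot e (z k)) = fun=> 1 by apply/funext => k; case: (zP k).
  exact: cvg_cst.
have xw : sup S = dot x w.
  apply: cvg_uniq vl _; have -> : v = fun k => dot x (z k) by apply/funext => k; case: (zP k).
  exact: cvg_dot (mcvg_cst UU x) zw.
exists (sup S), w; split=> //.
- by apply/eqP => w0; move: ew; rewrite w0 dot0r => /eqP; rewrite eq_sym oner_eq0.
- apply/Cdual => y Cy; have [->|y0] := eqVneq y 0; first by rewrite dot0l.
  have ey := Oe Cy y0; rewrite dotC dotBl dotZl subr_ge0 -ler_pdivrMr //.
  apply: ub_le_sup; first exact: supS.2.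
  exists ((dot e y)^-1 *: y); rewrite !dotZr mulVf ?gt_eqF // mulrC; split => //.
  by apply: coneZ; rewrite // invr_ge0 ltW.
- by rewrite dotBl dotZl ew mulr1 xw subrr.
Qed.

(* For an eigenvector [x], some [z] in [C] is orthogonal to the boundary point
   [mu e - x]; the Lie algebra condition there gives [l * mu = 0]. *)
Lemma sym_lie0 S : S^T = S -> lie_aut S -> e *m S = 0 -> S = 0.
Proof.
move=> sS LS eS; apply: sym_eq0 => // l x x0 xS; apply/eqP/negPn/negP => l0.
have key x' : x' *m S = l *: x' -> C (- x').
  move=> xS'; have [mu [z [Cz z0 Cmu muz]]] := max_face x'.
  have := LS _ _ Cmu Cz muz; rewrite mulmxBl -scalemxAl eS scaler0 sub0r dotNl xS' dotZl.
  move=> /eqP; rewrite oppr_eq0 mulf_eq0 (negPf l0) /= => /eqP xz.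
  move: muz; rewrite dotBl dotZl xz subr0 => /eqP; rewrite mulf_eq0 (gt_eqF (Oe Cz z0)) orbF.
  by move=> /eqP mu0; move: Cmu; rewrite mu0 scale0r sub0r.
have Cx := key x xS; have := key (- x); rewrite mulNmx xS scalerN opprK => /(_ erefl) Cx'.
by move: x0; rewrite (cone_pointed Cx' Cx) eqxx.
Qed.

Lemma sym_rescale (A : 'M[R]_n.+1) b : A^T = A -> (b *: (A - 1%:M))^T = b *: (A - 1%:M).
Proof. by move=> sA; rewrite linearZ /= linearB /= sA tr_scalar_mx. Qed.

(* If [u] were orthogonal to all [e S], then moving [e] to [e + u / k] by
   symmetric automorphisms [h = g^T g] would produce, after rescaling, a nonzero
   symmetric tangent vector contradicting the orthogonality (at scale [1 / k])
   or the uniqueness [sym_lie0] (at any larger scale). *)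
Lemma tang_span u : (forall S, S^T = S -> tang S -> dot u (e *m S) = 0) -> u = 0.
Proof.
move=> uS; apply/eqP/negPn/negP => u0; have r0 := ee_gt0.
have uu : 0 < dot u u by rewrite dot_gt0.
pose d := inv_seq R; have dpos k : 0 < d k := inv_seq_gt0 R k.
have d0 : d @ U --> (0 : R) := freeU.2.
pose x k := e + d k *: u.
have xe : mcvg U x e.
  by have := mcvgD UU (mcvg_cst UU e) (mcvgZ UU d0 (mcvg_cst UU u)); rewrite scale0r addr0.
have nOm := near_cone_int Oe xe.
have /choice[g gP] : forall k, exists g, cone_int (x k) -> aut g /\ e *m g = x k.
  (* Dummy value for the k, eventually absent, at which x_k is not interior. *)
  move=> k; have [Oxk|no] := pselect (cone_int (x k)); last by exists 0.
  by have [g ag eg] := Chom Oe Oxk; exists g.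
have agn : \forall k \near U, aut (g k) /\ e *m g k = x k.
  by apply: filterS nOm => k [Oxk _]; exact: gP.
pose z k := e *m invmx (g k)^T.
have dexn : \forall k \near U, dot (x k) e < 2 * dot e e.
  by apply: (cvg_lt_near UU (cvg_dot UU xe (mcvg_cst UU e))); lra.
have dezn : \forall k \near U, dot (z k) e <= 2 * dot e e.
  apply: filterS2 nOm agn => k [_ ordk] [agk egk].
  have Czk : C (z k) by apply: (aut_pos (aut_inv (aut_tr agk))); exact: cone_int_sub.
  have [+ _] := ordk _ Czk; rewrite (dotC (z k)).
  by have -> : dot (x k) (z k) = dot e e by rewrite /z -(dot_inv agk) egk.
have [k0 gk0] : exists k0, mcvg U g k0.
  apply: (posm_cvg Oe (M := 2 * dot e e)).
    by apply: filterS agn => k [[]].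
  by apply: filterS2 agn dexn => k [_ ->]; rewrite dotC => /ltW.
have [l0 gil0] : exists l0, mcvg U (fun k => invmx (g k)^T) l0.
  apply: (posm_cvg Oe (M := 2 * dot e e)).
    by apply: filterS agn => k [agk _]; exact: (aut_pos (aut_inv (aut_tr agk))).
  by apply: filterS dezn => k; rewrite dotC.
have gl1 : k0^T *m l0 = 1%:M.
  apply: (mcvg_uniq UU (mcvgM UU (mcvg_tr gk0) gil0)).
  apply: (mcvg_near UU _ (mcvg_cst UU 1%:M)); apply: filterS agn => k [/aut_unit ug _].
  by rewrite mulmxV // unitmx_tr.
have uk0 : k0 \in unitmx by rewrite -unitmx_tr; exact: (mulmx1_unit gl1).1.
have ak0 : aut k0 by apply: (aut_lim gk0 uk0); apply: filterS agn => k [].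
have ek0 : e *m k0 = e.
  apply: (mcvg_uniq UU (mcvgM UU (mcvg_cst UU e) gk0)); apply: (mcvg_near UU _ xe).
  by apply: filterS agn => k [].
have kk := stab_orth ak0 ek0; have kk' := mulmx1C kk.
have l0E : l0 = k0 by rewrite -[l0]mul1mx -kk -mulmxA gl1 mulmx1.
(* g_k tends only to some orthogonal k0 fixing e, whereas g_k^T g_k is symmetric and tends to 1. *)
pose h k := (g k)^T *m g k.
have h1 : mcvg U h 1%:M by rewrite -kk'; exact: mcvgM (mcvg_tr gk0) gk0.
have ahn : \forall k \near U, aut (h k).
  by apply: filterS agn => k [agk _]; apply: autM => //; exact: aut_tr.
have sh k : (h k)^T = h k by rewrite trmx_mul trmxK.
have ze : mcvg U z e by rewrite -[X in mcvg U z X]ek0 -l0E; exact: mcvgM (mcvg_cst UU e) gil0.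
(* The automorphism h_k carries z_k to x_k, so h_k - 1 records the gap between a point and its
   inverse. *)
have zhn : \forall k \near U, z k *m (h k - 1%:M) = x k - z k.
  apply: filterS agn => k [/aut_unit ug egk].
  by rewrite mulmxBr mulmx1 /z /h mulmxA mulmxKV ?unitmx_tr // egk.
have [c c0 cP] := inverse_strong.
have strong : \forall k \near U, 0 <= - dot (x k - e) (z k - e) /\
    c * dot (z k - e) (z k - e) <= - dot (x k - e) (z k - e).
  apply: filterS3 agn (filterI dexn dezn) zhn => k [agk egk] [/ltW dxk dzk] _.
  have := cP _ agk; rewrite /= egk -/(z k) => /(_ dxk dzk).
  have : - dot (x k - e) (z k - e) = dot (x k) e + dot (z k) e - 2 * dot e e.
    have xzk : dot (x k) (z k) = dot e e by rewrite /z -(dot_inv agk) egk.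
    by rewrite !dotBl !dotBr xzk (dotC e (z k)); ring.
  move=> ->; have := dot_ge0 (x k - e); have := dot_ge0 (z k - e).
  set a := dot (z k - e) _; set b := dot (x k - e) _; set f := _ - _ => a0 b0.
  have := mulr_ge0 (ltW c0) a0; have := mulr_ge0 (ltW c0) b0; rewrite mulrDr; lra.
have symlim (a : nat -> R) S : mcvg U (fun k => (a k)^-1 *: (h k - 1%:M)) S -> S^T = S.
  move=> hS; apply: (mcvg_uniq UU (mcvg_tr hS)); apply: (mcvg_near UU _ hS).
  by apply: nearW => k; exact: esym (sym_rescale _ (sh k)).
have eSlim (a : nat -> R) S : mcvg U (fun k => (a k)^-1 *: (h k - 1%:M)) S ->
    mcvg U (fun k => (a k)^-1 *: (x k - z k)) (e *m S).
  move=> hS; apply: (mcvg_near UU _ (mcvgM UU ze hS)); apply: filterS zhn => k <-.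
  by rewrite -scalemxAr.
pose nrm (A : 'M[R]_n.+1) : R := \sum_i \sum_j `|A i j|.
have nrm_ent A i j : `|A i j| <= nrm A.
  rewrite /nrm (bigD1 i) //= (bigD1 j) //= -addrA lerDl.
  by rewrite addr_ge0 ?sumr_ge0 // => k _; rewrite ?sumr_ge0.
case: (ultra_dichotomy UU (fun k => nrm (h k - 1%:M)) d) => [[M hM]|big].
  have [S hS] : exists S, mcvg U (fun k => (d k)^-1 *: (h k - 1%:M)) S.
    apply: (@mcvg_bounded _ _ UU _ _ _ M); apply: filterS hM => k hk i j.
    rewrite mxE normrM gtr0_norm ?invr_gt0 // ler_pdivrMl // mulrC.
    exact: le_trans (nrm_ent _ i j) hk.
  have tS : tang S.
    by apply: tang_intro d0 h1 hS; apply: filterS ahn => k ahk; split.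
  have := uS S (symlim _ _ hS) tS; rewrite dotC.
  have := cvg_dot UU (eSlim _ _ hS) (mcvg_cst UU u) => lim eS0.
  (* Inversion is decreasing: z_k - e pairs nonpositively with x_k - e = d_k u, so x_k - z_k
     advances along u at least as far as x_k - e. *)
  have : dot u u <= dot (e *m S) u.
    apply: (cvg_ge_near UU lim); apply: filterS strong => k [s1 _].
    rewrite dotZl ler_pdivlMl // -(ler_pM2l (dpos k)).
    have -> : d k * dot (x k - z k) u = dot (x k - z k) (x k - e).
      by rewrite -dotZr /x [e + _ - e]addrAC subrr add0r.
    have -> : x k - z k = (x k - e) - (z k - e) by rewrite opprB addrA subrK.
    rewrite dotBl (dotC (z k - e)).
    have -> : dot (x k - e) (x k - e) = d k * (d k * dot u u).
      by rewrite /x [e + _ - e]addrAC subrr add0r dotZl dotZr.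
    lra.
  by rewrite eS0 leNgt uu.
pose a k : R := nrm (h k - 1%:M).
have apos : \forall k \near U, 0 < a k by apply: filterS (big 0) => k; rewrite mul0r.
have nrm_cvg (A : nat -> 'M[R]_n.+1) B : mcvg U A B -> (fun k => nrm (A k)) @ U --> nrm B.
  move=> AB; apply: cvg_sumU => i _; apply: cvg_sumU => j _; apply: cvg_norm; exact: AB.
have a0 : a @ U --> (0 : R).
  have -> : 0 = nrm (1%:M - 1%:M).
    by rewrite subrr /nrm big1 // => i _; rewrite big1 // => j _; rewrite mxE normr0.
  by apply: nrm_cvg; apply: mcvgB h1 (mcvg_cst UU _).
have [S hS] : exists S, mcvg U (fun k => (a k)^-1 *: (h k - 1%:M)) S.
  apply: (@mcvg_bounded _ _ UU _ _ _ 1); apply: filterS apos => k ak i j.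
  by rewrite mxE normrM gtr0_norm ?invr_gt0 // ler_pdivrMl // mulr1; exact: nrm_ent.
have tS : tang S.
  by apply: tang_intro a0 h1 hS; apply: filterS2 ahn apos => k ahk ak; split.
have nS : nrm S = 1.
  apply: (cvg_near_cst UU (nrm_cvg _ _ hS)); apply: filterS apos => k ak.
  rewrite -[RHS](mulVf (lt0r_neq0 ak)) /a {3}/nrm mulr_sumr; apply: eq_bigr => i _.
  rewrite mulr_sumr; apply: eq_bigr => j _.
  by rewrite mxE normrM gtr0_norm ?invr_gt0.
have eS0 : e *m S = 0.
  apply/eqP; rewrite -dot_eq0; apply/eqP/le_anti; rewrite dot_ge0 andbT.
  (* Chosen so that |x_k - z_k|^2 <= K d_k^2, from |p - q|^2 <= 2|p|^2 + 2|q|^2 and |z_k - e| <=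
     |x_k - e| / c. Since d_k is negligible against a_k, the limit e S vanishes. *)
  pose K := 2 * (1 + c^-1 ^+ 2) * dot u u.
  have K0 : 0 < K by rewrite !mulr_gt0 // ltr_pwDl // sqr_ge0.
  have lim := cvg_dot UU (eSlim _ _ hS) (eSlim _ _ hS).
  apply/ler_addgt0Pr => eps eps0; rewrite add0r.
  pose M := K / eps + 1; have M1 : 1 <= M by rewrite lerDr divr_ge0 // ltW.
  apply: (cvg_le_near UU lim).
  apply: filterS3 strong apos (big M) => k [s1 s2] ak; rewrite -/(a k) => Mk.
  have dk := dpos k.
  have xk : dot (x k - e) (x k - e) = d k ^+ 2 * dot u u.
    by rewrite /x [e + _ - e]addrAC subrr add0r dotZl dotZr mulrA.
  have zk : dot (z k - e) (z k - e) <= c^-1 ^+ 2 * dot (x k - e) (x k - e).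
    have := cauchy_schwarz (x k - e) (z k - e).
    have := dot_ge0 (z k - e); have := dot_ge0 (x k - e).
    move: s1 s2; set A := dot (x k - e) (x k - e); set B := dot (z k - e) (z k - e).
    set D := dot _ _ => D0 cB A0 B0 DAB.
    rewrite exprVn ler_pdivlMl ?exprn_gt0 //.
    have [->|Bn] := eqVneq B 0; first by rewrite mulr0.
    have {Bn}{}B0 : 0 < B by rewrite lt_def Bn.
    rewrite -(ler_pM2r B0) -mulrA -expr2 -exprMn; apply: le_trans DAB.
    by rewrite -[leRHS]sqrrN ler_pXn2r // nnegrE mulr_ge0 // ltW.
  have xz : dot (x k - z k) (x k - z k) <= K * d k ^+ 2.
    have -> : x k - z k = (x k - e) - (z k - e) by rewrite opprB addrA subrK.
    move: zk xk; move: (x k - e) (z k - e) => p q zk xk.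
    have := dot_ge0 (p + q); rewrite !dotL (dotC q p); move: zk; rewrite xk /K.
    set A := d k ^+ 2; set B := dot u u; set E := dot q q; set F := dot p q; lra.
  rewrite dotZl dotZr mulrA -expr2 exprVn ler_pdivrMl ?exprn_gt0 //.
  apply: le_trans xz _.
  have : K <= eps * M by rewrite /M mulrDr mulr1 mulrCA mulfV ?gt_eqF // mulr1 lerDl ltW.
  have : (M * d k) ^+ 2 <= a k ^+ 2.
    by rewrite ler_pXn2r ?nnegrE ?ltW // mulr_gt0 // (lt_le_trans ltr01).
  rewrite exprMn => h2 h3; have dd := sqr_ge0 (d k).
  apply: (@le_trans _ _ (eps * (M ^+ 2 * d k ^+ 2))); last first.
    by rewrite mulrC ler_wpM2r // ltW.
  rewrite [leRHS]mulrA; apply: ler_wpM2r => //; apply: le_trans h3 _; rewrite ler_pM2l //.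
  by rewrite expr2 ler_peMr // (le_trans ler01).
have S0 := sym_lie0 (symlim _ _ hS) (tang_lie tS) eS0.
move: nS; rewrite S0 /nrm big1 => [/eqP|i _]; first by rewrite eq_sym oner_eq0.
by rewrite big1 // => j _; rewrite mxE normr0.
Qed.

(** The bracket of X and Y is not known to be tangent, so [tau_bracket] cannot be applied to it; but
    it is a limit of rescaled differences of the tangent vectors g Y g^-1 and Y. *)
Lemma tau_bracket2 W X Y : tang W -> tang X -> tang Y ->
  dot (e *m (W *m (X *m Y - Y *m X) - (X *m Y - Y *m X) *m W)) e = 0.
Proof.
move=> tW [g [d [agd d0 gX giX]]] tY.
have lim := mcvg_conj (Y := Y) agd d0 gX giX.
have limW := mcvgB UU (mcvgM UU (mcvg_cst UU W) lim) (mcvgM UU lim (mcvg_cst UU W)).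
apply: (cvg_near_cst UU (cvg_dot UU (mcvgM UU (mcvg_cst UU e) limW) (mcvg_cst UU e))).
apply: filterS agd => k [ag _].
rewrite -scalemxAr -scalemxAl -scalerBr -scalemxAr dotZl.
set Z := g k *m Y *m invmx (g k).
have -> : W *m (Z - Y) - (Z - Y) *m W = (W *m Z - Z *m W) - (W *m Y - Y *m W).
  by rewrite mulmxBr mulmxBl !opprD !opprK !addrA; congr (_ + _); rewrite addrAC.
by rewrite mulmxBr dotBl !tau_bracket // ?subrr ?mulr0 //; exact: tang_conj.
Qed.

(** Z = [X, Y] is antisymmetric, so [tau_bracket2] says that e Z is orthogonal to e W for every
    symmetric tangent W, and [tang_span] concludes. *)
Lemma tang_bracket_e X Y : X^T = X -> Y^T = Y -> tang X -> tang Y ->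
  e *m (X *m Y - Y *m X) = 0.
Proof.
move=> sX sY tX tY; apply: tang_span => W sW tW.
have sZ : (X *m Y - Y *m X)^T = - (X *m Y - Y *m X).
  by rewrite linearB /= !trmx_mul sX sY opprB.
have := tau_bracket2 tW tX tY; move: sZ; move: (X *m Y - Y *m X) => Z sZ.
rewrite mulmxBr dotBl !mulmxA (dot_mulr (e *m W) e Z) sZ mulmxN dotNr (dot_mulr (e *m Z) e W) sW.
by rewrite (dotC (e *m W)) => h; lra.
Qed.

Lemma lie_aut_sum (I : Type) (s : seq I) (P : pred I) (F : I -> 'M[R]_n.+1) :
  (forall i, P i -> lie_aut (F i)) -> lie_aut (\sum_(i <- s | P i) F i).
Proof.
move=> LF; elim/big_rec: _ => [|i A Pi LA]; last by apply: lie_autD => //; exact: LF.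
by move=> x y _ _ _; rewrite mulmx0 dot0l.
Qed.

(* [L v] is the multiplication by [v] of a Euclidean Jordan algebra with unit [e];
   the last clause says that the brackets [[L u, L v]] are derivations. *)
Definition jordan_mul (L : 'rV[R]_n.+1 -> 'M[R]_n.+1) :=
  [/\ forall a u v, L (a *: u + v) = a *: L u + L v,
      forall v, (L v)^T = L v,
      forall v, e *m L v = v,
      forall v, lie_aut (L v) &
      (L e = 1%:M) /\ (forall u v, u *m L v = v *m L u) /\
      forall u v w, L w *m (L u *m L v - L v *m L u) - (L u *m L v - L v *m L u) *m L w =
        L (w *m (L u *m L v - L v *m L u))].

(** By [tang_span] some vectors e S with S symmetric and tangent form a basis, and L extends
    linearly from it; by [sym_lie0], L v is the only symmetric element of the Lie algebra sending e
    to v. Commutativity of the product is the vanishing of e [L u, L v]. *)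
Lemma jordan_mul_ex : exists L, jordan_mul L.
Proof.
have [B uB PB] : exists2 B : 'M[R]_n.+1, B \in unitmx &
    forall i, exists S, [/\ S^T = S, tang S & row i B = e *m S].
  apply: (@basis_from_orth _ _ (fun p => exists S, [/\ S^T = S, tang S & p = e *m S])) => u h.
  by apply: tang_span => S sS tS; apply: h; exists S.
have /choice[X XP] := PB.
pose L (v : 'rV[R]_n.+1) : 'M[R]_n.+1 := \sum_i (v *m invmx B) 0 i *: X i.
have Llin a u v : L (a *: u + v) = a *: L u + L v.
  rewrite /L scaler_sumr -big_split /=; apply: eq_bigr => i _.
  by rewrite mulmxDl -scalemxAl !mxE scalerA scalerDl.
have Lsym v : (L v)^T = L v.
  by rewrite /L linear_sum; apply: eq_bigr => i _; rewrite linearZ /=; case: (XP i) => ->.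
have Le v : e *m L v = v.
  rewrite -[RHS](mulmxKV uB) [RHS]mulmx_sum_row /L mulmx_sumr; apply: eq_bigr => i _.
  by rewrite -scalemxAr; case: (XP i) => _ _ <-.
have LL v : lie_aut (L v).
  by apply: lie_aut_sum => i _; apply: lie_autZ; apply: tang_lie; case: (XP i).
have Lbr v Y : lie_aut Y -> lie_aut (L v *m Y - Y *m L v).
  move=> LY; rewrite /L mulmx_suml mulmx_sumr -sumrB; apply: lie_aut_sum => i _.
  rewrite -scalemxAl -scalemxAr -scalerBr; apply: lie_autZ; apply: tang_bracket => //.
  by case: (XP i).
have Luniq S : S^T = S -> lie_aut S -> S = L (e *m S).
  move=> sS LS; apply/eqP; rewrite -subr_eq0; apply/eqP/sym_lie0.
  - by rewrite linearB /= sS Lsym.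
  - by rewrite -scaleN1r; apply: lie_autD => //; exact: lie_autZ.
  - by rewrite mulmxBr Le subrr.
have eD u v : e *m (L u *m L v - L v *m L u) = 0.
  rewrite [L u]/L [L v]/L mulmx_suml mulmx_sumr -sumrB mulmx_sumr big1 // => i _.
  rewrite mulmx_sumr mulmx_suml -sumrB mulmx_sumr big1 // => j _.
  rewrite -!scalemxAl -!scalemxAr !scalerA (mulrC (_ 0 j)) -scalerBr -scalemxAr.
  by case: (XP i) (XP j) => si ti _ [sj tj _]; rewrite tang_bracket_e ?scaler0.
have LC u v : u *m L v = v *m L u.
  have := eD u v; rewrite mulmxBr !mulmxA !Le => /eqP; rewrite subr_eq0 => /eqP //.
exists L; split => //; split; first by rewrite -[in LHS](mulmx1 e) -Luniq ?tr_scalar_mx //; exact: lie_aut1.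
split=> // u v w; set D := L u *m L v - L v *m L u.
have sD : D^T = - D by rewrite /D linearB /= !trmx_mul !Lsym opprB.
have mulopD : lie_aut D by exact: Lbr.
(* The bracket of the symmetric L w with the antisymmetric D is symmetric and in the Lie algebra,
   and it sends e to w D because e D = 0. *)
rewrite [LHS]Luniq; first by rewrite mulmxBr !mulmxA Le eD mul0mx subr0.
  by rewrite linearB /= !trmx_mul sD Lsym mulNmx mulmxN opprK addrC.
exact: Lbr.
Qed.

(** * The Jordan algebra of the cone *)

Section Jordan.
Variable L : 'rV[R]_n.+1 -> 'M[R]_n.+1.
Hypothesis JL : jordan_mul L.

Let Llin a u v : L (a *: u + v) = a *: L u + L v. Proof. by case: JL. Qed.
Let Lsym v : (L v)^T = L v. Proof. by case: JL. Qed.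
Let Le v : e *m L v = v. Proof. by case: JL. Qed.
Let LL v : lie_aut (L v). Proof. by case: JL. Qed.
Let L1 : L e = 1%:M. Proof. by case: JL => _ _ _ _ []. Qed.
Let LC u v : u *m L v = v *m L u. Proof. by case: JL => _ _ _ _ [_ []]. Qed.

Lemma mulopD u v : L (u + v) = L u + L v.
Proof. by have := Llin 1 u v; rewrite !scale1r. Qed.

Lemma mulop0 : L 0 = 0.
Proof. by have := mulopD 0 0; rewrite addr0 => /eqP; rewrite -subr_eq subrr eq_sym => /eqP. Qed.

Lemma mulopZ a u : L (a *: u) = a *: L u.
Proof. by have := Llin a u 0; rewrite mulop0 !addr0. Qed.

Lemma mulopN u : L (- u) = - L u.
Proof. by rewrite -scaleN1r mulopZ scaleN1r. Qed.

Lemma mulopB u v : L (u - v) = L u - L v.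
Proof. by rewrite mulopD mulopN. Qed.

Lemma dot_mulop x y z : dot (x *m L y) z = dot x (z *m L y).
Proof. by rewrite dot_mulr Lsym. Qed.

(** Pairing the product with any a gives dot (x L(a)) y, which vanishes because L(a) is in the Lie
    algebra. *)
Lemma orth_mul x y : C x -> C y -> dot x y = 0 -> x *m L y = 0.
Proof.
move=> Cx Cy xy; rewrite LC; apply: dot_orth0 => a.
by rewrite dot_mulop (LC a) dotC; exact: LL.
Qed.

(** The argument of [sym_lie0] again: the extremal z of x satisfies x z = mu z by [orth_mul], and
    pairing with y gives mu = 0, so -x is in C. The same holds for -x. *)
Lemma mulop_ker0 x y : cone_int y -> x *m L y = 0 -> x = 0.
Proof.
move=> Oy xy.
have key x' : x' *m L y = 0 -> C (- x').
  move=> xy'; have [mu [z [Cz z0 Cmu muz]]] := max_face x'.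
  have := orth_mul Cmu Cz muz; rewrite mulmxBl -scalemxAl Le => /eqP; rewrite subr_eq0 => /eqP zx.
  have := congr1 (fun t => dot t y) zx; rewrite dotZl dot_mulop (LC y) -dot_mulop xy' dot0l.
  move=> /eqP; rewrite mulf_eq0 dotC (gt_eqF (Oy _ Cz z0)) orbF => /eqP mu0.
  by move: Cmu; rewrite mu0 scale0r sub0r.
have Cx := key x xy; have := key (- x); rewrite mulNmx xy oppr0 opprK => /(_ erefl) Cx'.
exact: cone_pointed.
Qed.

(** A negative eigenvalue -l of L y would give L (y + l e) a kernel, although y + l e is
    interior. *)
Lemma mulop_psd_int y x : cone_int y -> 0 <= dot (x *m L y) x.
Proof.
move=> Oy; have [->|x0] := eqVneq x 0; first by rewrite dot0r.
have sN : (- L y)^T = - L y by rewrite linearN /= Lsym.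
have [l [z [z0 _ zl zmax]]] :=
  @rayleigh _ _ (- L y) 0 x sN (fun t _ => mulmx0 _ (t *m - L y)) x0 (mulmx0 _ x).
have l0 : l <= 0.
  rewrite leNgt; apply/negP => l0.
  move/eqP: z0; apply; apply: (@mulop_ker0 z (y + l *: e)).
    by apply: cone_intD => //; apply: coneZ; [exact: ltW|exact: cone_int_sub].
  by rewrite mulopD mulopZ L1 mulmxDr -scalemxAr mulmx1 -zl mulmxN subrr.
have := zmax x (mulmx0 _ x); rewrite mulmxN dotNl => h.
have := dot_ge0 x => ?; nra.
Qed.

Lemma mulop_psd y x : C y -> 0 <= dot (x *m L y) x.
Proof.
move=> Cy; apply/ler_addgt0Pr => a a0.
have x0 := dot_ge0 x.
pose b := a / (dot x x + 1); have b0 : 0 < b by rewrite divr_gt0 // ltr_wpDl.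
have Oy : cone_int (b *: e + y) by apply: cone_intD => //; exact: cone_intZ.
have := mulop_psd_int x Oy; rewrite mulopD mulopZ L1 mulmxDr -scalemxAr mulmx1 dotDl dotZl => h.
have : b * dot x x <= a by rewrite /b mulrAC ler_pdivrMr ?ltr_wpDl // ler_pM2l // lerDl.
lra.
Qed.

Lemma cone_sq x : C (x *m L x).
Proof. by apply/Cdual => y Cy; rewrite dotC dot_mulop LC -dot_mulop mulop_psd. Qed.

(* [L u L v - L v L u] is a derivation; read as an identity in the operand [v]
   this expresses [L] of a triple product. *)
Lemma mulop_triple c d a : L (c *m L d *m L a) =
  L (c *m L d) *m L a + L (c *m L a) *m L d + L (d *m L a) *m L c
  - L c *m L a *m L d - L d *m L a *m L c.
Proof.
apply: mx_eq => v.
have := JL; case=> _ _ _ _ [_ [_ /(_ a v d)]].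
set D := L a *m L v - L v *m L a => /(congr1 (fun A => c *m A)).
have tD t : t *m D = t *m L a *m L v - t *m L v *m L a by rewrite mulmxBr !mulmxA.
rewrite mulmxBr !mulmxA !tD (LC c (_ - _)) !mulmxBl => h.
rewrite !(mulmxDr, mulmxBr, mulmxN) !mulmxA.
rewrite [v *m L (c *m L d *m L a)]LC [v *m L (c *m L d)]LC [v *m L (c *m L a)]LC.
rewrite [v *m L (d *m L a)]LC [v *m L c]LC [v *m L d]LC.
move: h; move: (c *m L d *m L a *m L v) (c *m L d *m L v *m L a) (d *m L a *m L v *m L c)
  (d *m L v *m L a *m L c) (c *m L a *m L v *m L d) (c *m L v *m L a *m L d) => t t1 t2 t3 t4 t5.
move=> /rowP h; apply/rowP => i; have := h i; rewrite !mxE => ?; lra.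
Qed.

Definition op_commute x y := L x *m L y = L y *m L x.

Lemma op_commuteC x y : op_commute x y -> op_commute y x. Proof. by []. Qed.

(** [mulop_triple] at x, x, x expresses L(x^2) L(x) through L(x^3) and L(x)^3, which are symmetric;
    symmetric operators with a symmetric product commute. *)
Lemma jordan_id x : op_commute (x *m L x) x.
Proof.
have h := mulop_triple x x x.
have h1 : 3 *: (L (x *m L x) *m L x) = L (x *m L x *m L x) + 2 *: (L x *m L x *m L x).
  rewrite h; move: (L (x *m L x) *m L x) (L x *m L x *m L x) => A B.
  apply/matrixP => i j; rewrite !mxE; ring.
have h2 : 3 *: (L (x *m L x) *m L x) = 3 *: (L x *m L (x *m L x)).
  have := congr1 trmx h1; rewrite !linearD !linearZ /= !trmx_mul !Lsym => ->.
  by rewrite h1 mulmxA.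
apply: (scalerI (a := 3)) h2; by rewrite pnatr_eq0.
Qed.

(** The part of [jordan_id] quadratic in x and linear in y, extracted by polarisation. *)
Lemma jordan_lin x y :
  L (x *m L x) *m L y - L y *m L (x *m L x) =
  2 *: (L x *m L (x *m L y) - L (x *m L y) *m L x).
Proof.
have hp := jordan_id (x + y); have hm := jordan_id (x - y).
have hx := jordan_id x; have hy := jordan_id y.
move: hp hm hx hy; rewrite /op_commute !(mulopD, mulopB, mulmxDl, mulmxDr, mulmxBl, mulmxBr, mulopN, mulNmx, mulmxN).
rewrite (LC y x).
move: (L (x *m L x)) (L (x *m L y)) (L (y *m L y)) (L x) (L y) => X2 XY Y2 X Y.
move=> /matrixP hp /matrixP hm /matrixP hx /matrixP hy; apply/matrixP => i j.
have := hp i j; have := hm i j; have := hx i j; have := hy i j; rewrite !mxE.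
move=> *; lra.
Qed.

(** e L(w)^m is the Jordan power w^m. [mulop_triple] writes L(w^(m+2)) through L of w^m, w^(m+1), w
    and w^2, so the induction carries two consecutive powers. *)
Lemma pow_comm (Z : 'M[R]_n.+1) w : Z *m L w = L w *m Z ->
  Z *m L (w *m L w) = L (w *m L w) *m Z ->
  forall m, Z *m L (e *m L w ^+ m) = L (e *m L w ^+ m) *m Z.
Proof.
move=> Zw Zww m; suff [] : Z *m L (e *m L w ^+ m) = L (e *m L w ^+ m) *m Z /\
  Z *m L (e *m L w ^+ m.+1) = L (e *m L w ^+ m.+1) *m Z by [].
elim: m => [|m [IH1 IH2]].
  by rewrite expr0 expr1 mulmx1 Le L1 mulmx1 mul1mx.
split=> //; set x := e *m L w ^+ m in IH1.
have x1 : e *m L w ^+ m.+1 = x *m L w by rewrite exprSr -mulmxE mulmxA.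
have -> : e *m L w ^+ m.+2 = x *m L w *m L w by rewrite exprSr -mulmxE mulmxA x1.
rewrite x1 in IH2.
rewrite mulop_triple.
by do ?[apply: comm_mxB | apply: comm_mxD | apply: comm_mxM].
Qed.

Lemma poly_comm (Z : 'M[R]_n.+1) w p : Z *m L w = L w *m Z ->
  Z *m L (w *m L w) = L (w *m L w) *m Z ->
  Z *m L (e *m horner_mx (L w) p) = L (e *m horner_mx (L w) p) *m Z.
Proof.
move=> Zw Zww; have pc := pow_comm Zw Zww.
rewrite -[p]coefK poly_def rmorph_sum /= mulmx_sumr.
elim/big_rec: _ => [|i x _ IH]; first by rewrite mulop0 mulmx0 mul0mx.
rewrite mulopD mulmxDr mulmxDl IH; congr (_ + _).
by rewrite linearZ /= rmorphXn /= horner_mx_X -scalemxAr mulopZ -scalemxAr pc scalemxAl.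
Qed.

(** The c_i are the images of e under the spectral projections of L x. Being polynomials in x, they
    have L(c_j) commuting with L x, which turns their Jordan products into products of
    projections. *)
Lemma spectral_idem x : exists (m : nat) (l : 'I_m -> R) (c : 'I_m -> 'rV[R]_n.+1),
  [/\ \sum_i c i = e, forall i, c i *m L (c i) = c i,
      forall i j, i != j -> c i *m L (c j) = 0 & x = \sum_i l i *: c i].
Proof.
have [m [l [p [sumE EE Eo AE]]]] := spectral_poly (Lsym x).
exists m, l, (fun i => e *m horner_mx (L x) (p i)).
have cj i j : e *m horner_mx (L x) (p i) *m L (e *m horner_mx (L x) (p j)) =
    e *m (horner_mx (L x) (p j) *m horner_mx (L x) (p i)).
  set cc := e *m horner_mx (L x) (p j).
  have cx : L cc *m L x = L x *m L cc.
    by rewrite [RHS]poly_comm //; exact: esym (jordan_id x).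
  have -> : e *m horner_mx (L x) (p i) *m L cc = e *m L cc *m horner_mx (L x) (p i).
    by rewrite -!mulmxA; congr (_ *m _); apply/esym; apply: comm_mx_horner; exact: cx.
  by rewrite Le mulmxA.
split.
- by rewrite -mulmx_sumr sumE mulmx1.
- by move=> i; rewrite cj EE.
- by move=> i j ij; rewrite cj Eo ?mulmx0 // eq_sym.
- rewrite -[LHS]Le -[in LHS](mulmx1 (L x)) -sumE !mulmx_sumr; apply: eq_bigr => i _.
  by rewrite AE -scalemxAr.
Qed.

Lemma idem_C c : c *m L c = c -> C c.
Proof. by move=> <-; exact: cone_sq. Qed.

Lemma spectral_unit x : C (e + x) -> C (e - x) ->
  exists (m : nat) (l : 'I_m -> R) (c : 'I_m -> 'rV[R]_n.+1),
  [/\ \sum_i c i = e, forall i, c i *m L (c i) = c i,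
      forall i j, i != j -> c i *m L (c j) = 0,
      x = \sum_i l i *: c i & forall i, `|l i| <= 1].
Proof.
move=> Cp Cm; have [m [l [c [sc cc co xE]]]] := spectral_idem x.
(* A vanishing c_i leaves its coefficient unconstrained, so it is reset to 0; the others are bounded
   by pairing e + x and e - x with c_i. *)
exists m, (fun i => if c i == 0 then 0 else l i), c; split=> //.
  by rewrite xE; apply: eq_bigr => i _; case: eqP => // ->; rewrite !scaler0.
move=> i; case: eqP => [_|/eqP ci0]; first by rewrite normr0.
have cd j : j != i -> dot (c j) (c i) = 0.
  by move=> ji; rewrite -(Le (c j)) dot_mulop co ?dot0r // eq_sym.
have xc : dot x (c i) = l i * dot (c i) (c i).
  rewrite xE dot_suml (bigD1 i) //= dotZl big1 ?addr0 // => j ji.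
  by rewrite dotZl cd ?mulr0.
have ec : dot e (c i) = dot (c i) (c i) by rewrite -{1}(cc i) -dot_mulop Le.
have ci : 0 < dot (c i) (c i) by rewrite dot_gt0.
have Ci := idem_C (cc i).
have := cone_dot_ge0 Cp Ci; have := cone_dot_ge0 Cm Ci; rewrite dotBl dotDl ec xc.
set d := dot _ _ in ci *; rewrite ler_norml => h1 h2.
have {}h1 : 0 <= (1 - l i) * d by rewrite mulrBl mul1r.
have {}h2 : 0 <= (1 + l i) * d by rewrite mulrDl mul1r.
by move: h1 h2; rewrite !pmulr_lge0 // => h1 h2; apply/andP; split; lra.
Qed.

(** * Decomposition of positive maps from the square cone *)

Section Decomposition.
(** Abstract form of the claim that the map sending the basis of R^3 to s, a, b belongs to
    [lor_fact]. *)
Variable LF : 'rV[R]_n.+1 -> 'rV[R]_n.+1 -> 'rV[R]_n.+1 -> Prop.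
Hypothesis LFD : forall s a b s' a' b', LF s a b -> LF s' a' b' -> LF (s + s') (a + a') (b + b').
Hypothesis LFZ : forall (t : R) s a b, 0 <= t -> LF s a b -> LF (t *: s) (t *: a) (t *: b).
(** The source of factorizations: the cone of the quadratic form is Lorentzian for |l| < 1 and
    degenerates at l = 1 and l = -1. *)
Hypothesis LFlor : forall c u v (l : R), -1 <= l -> l <= 1 ->
  (forall x y z : R, 0 <= x -> y ^+ 2 + 2 * l * y * z + z ^+ 2 <= x ^+ 2 ->
    C (x *: c + y *: u + z *: v)) -> LF c u v.

Lemma LF0 : LF 0 0 0.
Proof.
by apply: (@LFlor _ _ _ 0) => [||x y z _ _]; rewrite ?lerN10 ?ler01 // !scaler0 !addr0; exact: cone0.
Qed.

Lemma LF_sum m (s a b : 'I_m -> 'rV[R]_n.+1) : (forall i, LF (s i) (a i) (b i)) ->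
  LF (\sum_i s i) (\sum_i a i) (\sum_i b i).
Proof.
move=> h; elim/big_rec3: _ => [|i x y z _ IH]; [exact: LF0|exact: LFD].
Qed.

(* Peirce decomposition of [n0] with respect to the idempotent [c]. *)
Lemma idem_piece c n0 w1 (q : R) : c *m L c = c -> c *m L (c *m L n0) = c *m L n0 ->
  n0 *m L n0 = w1 -> c *m L w1 = q *: c ->
  (c *m L n0) *m L (c *m L n0) = q *: c.
Proof.
move=> cc cn nn cw; set n1 := c *m L n0 in cn *.
pose m0 := n0 - n1.
have cm : c *m L m0 = 0 by rewrite mulopB mulmxBr cn subrr.
have c1 : op_commute c n1.
  (* With c^2 = c and c n1 = n1, the commutator of L c and L n1 equals twice itself. *)
  have := jordan_lin c n1; rewrite cc cn => /eqP; rewrite -subr_eq0 => /eqP.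
  rewrite /op_commute; move: (L c *m L n1) (L n1 *m L c) => A B h.
  apply/eqP; rewrite -subr_eq0; apply/eqP/matrixP => i j.
  by have /matrixP/(_ i j) := h; rewrite !mxE => h'; lra.
have c0 : op_commute c m0.
  have := jordan_lin c m0; rewrite cc cm mulop0 mulmx0 mul0mx subr0 scaler0 => /eqP.
  by rewrite subr_eq0 => /eqP.
have n1c : n1 *m L c = n1 by rewrite LC.
have m0c : m0 *m L c = 0 by rewrite LC.
have e11 : n1 *m L n1 *m L c = n1 *m L n1 by rewrite -mulmxA -c1 mulmxA n1c.
have e10 : n1 *m L m0 = 0.
  have h1 : n1 *m L m0 *m L c = n1 *m L m0 by rewrite -mulmxA -c0 mulmxA n1c.
  by rewrite -h1 (LC n1) -mulmxA -c1 mulmxA m0c mul0mx.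
have e00 : m0 *m L m0 *m L c = 0 by rewrite -mulmxA -c0 mulmxA m0c mul0mx.
have nE : n0 = n1 + m0 by rewrite addrC subrK.
have sq : (n1 + m0) *m L (n1 + m0) = n1 *m L n1 + m0 *m L m0.
  by rewrite mulopD mulmxDl !mulmxDr e10 (LC m0 n1) e10 addr0 add0r.
by rewrite -cw -nn [RHS]LC nE sq mulmxDl e11 e00 addr0.
Qed.

(** x c + n1 is the square of al c + be n1 once 2 al be = 1 and al^2 + be^2 q = x; eliminating be
    leaves a quadratic equation for al^2, solvable because q <= x^2. If q |c|^2 <= 0, then n1 = 0,
    as |n1|^2 = q |c|^2. *)
Lemma lorentz_sq c n1 (q x : R) : c *m L c = c -> c *m L n1 = n1 -> n1 *m L n1 = q *: c ->
  0 <= x -> q <= x ^+ 2 -> C (x *: c + n1).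
Proof.
move=> cc cn nn x0 qx.
have n1n1 : dot n1 n1 = q * dot c c.
  rewrite -{1}(Le n1) dot_mulop nn dotZr; congr (_ * _).
  by rewrite -{1}cc -dot_mulop Le.
have n1z : q * dot c c <= 0 -> n1 = 0.
  by rewrite -n1n1 => h; apply/eqP; rewrite -dot_eq0; apply/eqP/le_anti; rewrite h dot_ge0.
have Cc := idem_C cc.
have [q0|q0] := leP (q * dot c c) 0; first by rewrite n1z // addr0; exact: coneZ.
have xx : 0 < x.
  rewrite lt_def x0 andbT; apply: contraTneq q0 => x00; rewrite -leNgt.
  by apply: mulr_le0_ge0; [move: qx; rewrite x00 expr0n|exact: dot_ge0].
have c0 := dot_ge0 c.
have qpos : 0 < q by rewrite ltNge; apply: contraL q0 => q0; rewrite -leNgt mulr_le0_ge0.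
pose s := Num.sqrt (x ^+ 2 - q); have s0 : 0 <= s by exact: sqrtr_ge0.
have s2 : s ^+ 2 = x ^+ 2 - q by rewrite sqr_sqrtr // subr_ge0.
have xs : 0 < x + s by rewrite ltr_wpDr.
pose al := Num.sqrt ((x + s) / 2).
have al2 : al ^+ 2 = (x + s) / 2 by rewrite sqr_sqrtr // divr_ge0 // ltW.
have al0 : 0 < al by rewrite sqrtr_gt0 divr_gt0.
pose be := (2 * al)^-1.
have ab : al * be = 1 / 2 by rewrite /be; field; rewrite gt_eqF.
have abq : al ^+ 2 + be ^+ 2 * q = x.
  rewrite /be exprVn exprMn al2; have -> : q = (x - s) * (x + s) by rewrite -subr_sqr s2; ring.
  by field; rewrite gt_eqF.
have -> : x *: c + n1 = (al *: c + be *: n1) *m L (al *: c + be *: n1); last exact: cone_sq.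
rewrite mulopD !mulopZ mulmxDr !mulmxDl -!scalemxAl -!scalemxAr cc (LC n1 c) cn nn -abq.
apply/rowP => i; rewrite !mxE; move: (c 0 i) (n1 0 i) => ci ni.
have -> : (al ^+ 2 + be ^+ 2 * q) * ci + ni = (al ^+ 2 + be ^+ 2 * q) * ci + 2 * (al * be) * ni.
  by rewrite ab; field.
ring.
Qed.

(* [w = u v] operator-commutes with [u] and [v], so the spectral idempotents of
   [w] cut [e], [u], [v] into pieces on which [(y u + z v)^2] is the scalar
   [y^2 + 2 l y z + z^2]: each piece factors through a three-dimensional Lorentz cone. *)
Lemma two_symmetries u v : u *m L u = e -> v *m L v = e -> LF e u v.
Proof.
move=> uu vv; pose w := u *m L v.
(* As u^2 = e and L e = 1, the linearised identity at u, v has left side 0, and its right side is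
   twice the commutator of L u and L w. *)
have wu : op_commute w u.
  have := jordan_lin u v; rewrite uu L1 mulmx1 mul1mx subrr => /esym/eqP.
  by rewrite scaler_eq0 pnatr_eq0 /= subr_eq0 => /eqP; exact: op_commuteC.
have wv : op_commute w v.
  have := jordan_lin v u; rewrite vv L1 mulmx1 mul1mx subrr (LC v u) => /esym/eqP.
  by rewrite scaler_eq0 pnatr_eq0 /= subr_eq0 => /eqP; exact: op_commuteC.
(* The linearised identity at w, x reduces this to L w commuting with L(w x); as x^2 = e,
   [mulop_triple] writes L((x y) x) in terms of L x, L y and L w. *)
have ww2 x y : x *m L x = e -> x *m L y = w -> op_commute w x -> op_commute w y -> op_commute (w *m L w) x.
  move=> xx xy wx wy; have := jordan_lin w x.
  have -> : L w *m L (w *m L x) = L (w *m L x) *m L w.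
    have -> : w *m L x = x *m L y *m L x by rewrite xy.
    rewrite mulop_triple xx xy L1 mul1mx (LC y x) xy.
    by do ?[apply: comm_mxB | apply: comm_mxD | apply: comm_mxM].
  by rewrite subrr scaler0 => /eqP; rewrite subr_eq0 => /eqP.
have wwu : op_commute (w *m L w) u by exact: (ww2 u v).
have wwv : op_commute (w *m L w) v by apply: (ww2 v u) => //; rewrite LC.
have [m [l [p [sumE EE Eo AE]]]] := spectral_poly (Lsym w).
pose E i := horner_mx (L w) (p i).
pose c i := e *m E i.
have Ew i : L w *m E i = E i *m L w by apply: comm_mx_horner.
have Ecomm x i : op_commute w x -> L x *m E i = E i *m L x.
  by move=> wx; apply: comm_mx_horner; exact: esym wx.
have cw i : L w *m L (c i) = L (c i) *m L w by apply: poly_comm => //; exact: esym (jordan_id w).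
have cu i : L u *m L (c i) = L (c i) *m L u by apply: poly_comm; exact: op_commuteC.
have cv i : L v *m L (c i) = L (c i) *m L v by apply: poly_comm; exact: op_commuteC.
have cE i : L (c i) *m E i = E i *m L (c i) by apply: comm_mx_horner; exact: esym (cw i).
have cc i : c i *m L (c i) = c i.
  by rewrite {1}/c -mulmxA -cE mulmxA Le /c -mulmxA EE.
have piece x i : op_commute w x -> L x *m L (c i) = L (c i) *m L x ->
    c i *m L x = x *m E i /\ c i *m L (c i *m L x) = c i *m L x.
  move=> wx cx; split; first by rewrite /c -mulmxA -Ecomm // mulmxA Le.
  by rewrite LC -mulmxA cx mulmxA cc.
have -> : e = \sum_i c i by rewrite -mulmx_sumr sumE mulmx1.
have sumx x : x = \sum_i x *m E i by rewrite -mulmx_sumr sumE mulmx1.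
rewrite [u]sumx [v]sumx; apply: LF_sum => i.
have [uE ucE] := piece u i wu (cu i); have [vE vcE] := piece v i wv (cv i).
rewrite -uE -vE.
have nL (y z : R) : c i *m L (y *: u + z *: v) = y *: (c i *m L u) + z *: (c i *m L v).
  by rewrite mulopD !mulopZ mulmxDr -!scalemxAr.
have cn (y z : R) : c i *m L (c i *m L (y *: u + z *: v)) = c i *m L (y *: u + z *: v).
  by rewrite nL mulopD !mulopZ mulmxDr -!scalemxAr ucE vcE.
have key (y z : R) : c i *m L (y *: u + z *: v) *m L (c i *m L (y *: u + z *: v)) =
    (y ^+ 2 + 2 * l i * y * z + z ^+ 2) *: c i.
  apply: (@idem_piece (c i) (y *: u + z *: v) ((y ^+ 2 + z ^+ 2) *: e + (2 * y * z) *: w)) => //.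
  - rewrite !(mulopD, mulopZ) !(mulmxDr, mulmxDl) -!scalemxAl -!scalemxAr uu vv (LC v u) -/w.
    apply/rowP => j; rewrite !mxE; ring.
  - rewrite !(mulopD, mulopZ) L1 mulmxDr -!scalemxAr mulmx1.
    have -> : c i *m L w = l i *: c i by rewrite /c -mulmxA -Ew AE scalemxAr.
    by rewrite scalerA -scalerDl; congr (_ *: _); ring.
have [c0|c0] := eqVneq (c i) 0; first by rewrite c0 !mul0mx; exact: LF0.
(* Up to the factor |c_i|^2 this is the squared norm of c_i (y u + z v); its values at (1, 1) and
   (1, -1) give |l_i| <= 1. *)
have form (y z : R) : 0 <= y ^+ 2 + 2 * l i * y * z + z ^+ 2.
  have := dot_ge0 (c i *m L (y *: u + z *: v)).
  rewrite -{1}(Le (c i *m L (y *: u + z *: v))) dot_mulop key dotZr -{1}(cc i) -dot_mulop Le.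
  by rewrite pmulr_lge0 // dot_gt0.
apply: (@LFlor _ _ _ (l i)).
- by have := form 1 1; lra.
- by have := form 1 (-1); lra.
- move=> x y z x0 le; have := lorentz_sq (cc i) (cn y z) (key y z) x0 le.
  by rewrite mulopD !mulopZ mulmxDr -!scalemxAr addrA.
Qed.

(** A point of the cube is a convex combination of vertices, one coordinate at a time; in the
    induction only coordinates of index below k may differ from 1 and -1. *)
Lemma conv_signs m (c : 'I_m -> 'rV[R]_n.+1) (P : 'rV[R]_n.+1 -> Prop) :
  (forall (t : R) x y, 0 <= t -> t <= 1 -> P x -> P y -> P (t *: x + (1 - t) *: y)) ->
  (forall s : 'I_m -> R, (forall i, s i = 1 \/ s i = -1) -> P (\sum_i s i *: c i)) ->
  forall l : 'I_m -> R, (forall i, `|l i| <= 1) -> P (\sum_i l i *: c i).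
Proof.
move=> Pconv Psgn.
suff H k : forall l : 'I_m -> R, (forall i, `|l i| <= 1) ->
    (forall i : 'I_m, (k <= i)%N -> l i = 1 \/ l i = -1) -> P (\sum_i l i *: c i).
  by move=> l hl; apply: (H m) => // i; rewrite leqNgt ltn_ord.
elim: k => [|k IH] l hl sl; first by apply: Psgn => i; exact: sl.
have [km|mk] := ltnP k m; last first.
  by apply: IH => // i ki; have := leq_ltn_trans (leq_trans mk ki) (ltn_ord i); rewrite ltnn.
pose ik := Ordinal km; pose t := (1 + l ik) / 2.
pose up (r : R) i := if i == ik then r else l i.
have lk := hl ik; rewrite ler_norml in lk; case/andP: lk => lk1 lk2.
have -> : \sum_i l i *: c i = t *: (\sum_i up 1 i *: c i) + (1 - t) *: (\sum_i up (-1) i *: c i).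
  rewrite !scaler_sumr -big_split /=; apply: eq_bigr => i _; rewrite !scalerA -scalerDl.
  by congr (_ *: _); rewrite /up; case: eqP => [->|_]; rewrite /t; field.
have upP r : r = 1 \/ r = -1 -> P (\sum_i up r i *: c i).
  move=> hr; apply: IH => i; rewrite /up; case: eqP => [_|/eqP ne] //.
    by case: hr => ->; rewrite ?normrN1 ?normr1.
  by move=> ki; apply: sl; rewrite ltn_neqAle ki andbT; apply: contra_neq ne => ki'; exact: val_inj.
by apply: Pconv; [rewrite /t; lra|rewrite /t; lra|apply: upP; left|apply: upP; right].
Qed.

Lemma sign_sq m (c : 'I_m -> 'rV[R]_n.+1) (s : 'I_m -> R) :
  \sum_i c i = e -> (forall i, c i *m L (c i) = c i) ->
  (forall i j, i != j -> c i *m L (c j) = 0) -> (forall i, s i = 1 \/ s i = -1) ->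
  (\sum_i s i *: c i) *m L (\sum_i s i *: c i) = e.
Proof.
move=> sc cc co ss; rewrite mulmx_suml -sc; apply: eq_bigr => i _.
rewrite LC mulmx_suml (bigD1 i) //= big1 ?addr0; last first.
  by move=> j ji; rewrite mulopZ -scalemxAl -scalemxAr co // !scaler0.
by rewrite mulopZ -scalemxAl -scalemxAr cc scalerA; case: (ss i) => ->; rewrite ?mulrNN mulr1 scale1r.
Qed.

(** Each of a and b is a point of a cube whose vertices are symmetries by [sign_sq]. The two
    spectral frames are unrelated, so convexity is used in a with b fixed, then in b. *)
Lemma unit_decomposition a b : C (e + a) -> C (e - a) -> C (e + b) -> C (e - b) -> LF e a b.
Proof.
move=> Ca Ca' Cb Cb'.
have [m [l [c [sc cc co -> l1]]]] := spectral_unit Ca Ca'.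
have [m' [l' [c' [sc' cc' co' -> l1']]]] := spectral_unit Cb Cb'.
have cx x (t : R) : t *: x + (1 - t) *: x = x :> 'rV[R]_n.+1.
  by rewrite -scalerDl addrC subrK scale1r.
apply: (@conv_signs _ c (fun a => LF e a _)) => // [t x y t0 t1 Px Py|s ss].
  by rewrite -(cx e t) -(cx (\sum_i _) t); apply: LFD; apply: LFZ => //; rewrite subr_ge0.
apply: (@conv_signs _ c' (fun b => LF e _ b)) => // [t x y t0 t1 Px Py|s' ss'].
  by rewrite -(cx e t) -(cx (\sum_i _) t); apply: LFD; apply: LFZ => //; rewrite subr_ge0.
by apply: two_symmetries; exact: sign_sq.
Qed.

Hypothesis LFpos : forall g s a b, posm g -> LF s a b -> LF (s *m g) (a *m g) (b *m g).

(* [s] may lie on the boundary: [s + e/k = e g_k] with [g_k] automorphisms, whose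
   limit is only a positive map. *)
Lemma cone_decomposition s a b :
  C (s + a) -> C (s - a) -> C (s + b) -> C (s - b) -> LF s a b.
Proof.
move=> Ca Ca' Cb Cb'.
have Cs : C s.
  have -> : s = 2^-1 *: ((s + a) + (s - a)) by apply/rowP => i; rewrite !mxE; field.
  by apply: coneZ (coneD Ca Ca'); rewrite invr_ge0.
pose d := inv_seq R; have dpos k : 0 < d k := inv_seq_gt0 R k.
pose x k := d k *: e + s.
have Ox k : cone_int (x k) by apply: cone_intD => //; exact: cone_intZ.
have /choice[g gP] k : exists g, aut g /\ e *m g = x k by have [g] := Chom Oe (Ox k); exists g.
have xs : mcvg U x s.
  have := mcvgD UU (mcvgZ UU freeU.2 (mcvg_cst UU e)) (mcvg_cst UU s).
  by rewrite scale0r add0r.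
have d1 k : d k <= 1 by rewrite invf_le1 ?ltr0n // ler1n.
have [g0 gg0] : exists g0, mcvg U g g0.
  apply: (posm_cvg Oe (M := dot e e + dot e s)).
    by apply: nearW => k; case: (gP k) => -[].
  apply: nearW => k; case: (gP k) => _ ->; rewrite dotDr dotZr lerD2r ler_piMl //.
  exact: dot_ge0.
have pg0 : posm g0 by apply: (posm_lim gg0); apply: nearW => k; case: (gP k) => -[].
have eg0 : e *m g0 = s.
  apply: (mcvg_uniq UU (mcvgM UU (mcvg_cst UU e) gg0)); apply: (mcvg_near UU _ xs).
  by apply: nearW => k; case: (gP k).
(* The pullbacks t g_k^-1 stay in the bounded order interval between -e and e, since e + t g_k^-1 =
   (x_k + t) g_k^-1 and likewise for -t; so they converge even if g0 is singular. *)
have lift t : C (s + t) -> C (s - t) -> exists t', [/\ C (e + t'), C (e - t') & t' *m g0 = t].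
  move=> Ct Ct'; have [c c0 cP] := interval_bounded Oe.
  have CC k : C (e + t *m invmx (g k)) /\ C (e - t *m invmx (g k)).
    have [[ug pg pgi] eg] := gP k.
    have -> : e = x k *m invmx (g k) by rewrite -eg mulmxK.
    rewrite -mulmxDl -mulmxBl /x -!addrA; split; apply: pgi; apply: coneD => //.
      by apply: coneZ; [exact: ltW|exact: cone_int_sub].
    by apply: coneZ; [exact: ltW|exact: cone_int_sub].
  have [t' tt'] : exists t', mcvg U (fun k => t *m invmx (g k)) t'.
    apply: (@mcvg_dot_bounded _ _ _ UU _ (c * dot e e ^+ 2)).
    by apply: nearW => k; have [C1 C2] := CC k; exact: cP.
  exists t'; split.
  - apply: (cone_lim (mcvgD UU (mcvg_cst UU e) tt')); apply: nearW => k; exact: (CC k).1.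
  - apply: (cone_lim (mcvgB UU (mcvg_cst UU e) tt')); apply: nearW => k; exact: (CC k).2.
  - apply: (mcvg_uniq UU (mcvgM UU tt' gg0)); apply: (mcvg_near UU _ (mcvg_cst UU t)).
    by apply: nearW => k; have [/aut_unit ug _] := gP k; rewrite mulmxKV.
have [a' [Ca1 Ca2 <-]] := lift a Ca Ca'.
have [b' [Cb1 Cb2 <-]] := lift b Cb Cb'.
by rewrite -eg0; apply: LFpos => //; exact: unit_decomposition.
Qed.

End Decomposition.

End Jordan.
End Center.
End SelfdualCone.

(** * Transport to coordinates *)

Lemma gram_sqrt (R : realType) n (G : 'M[R]_n.+1) : G^T = G ->
  (forall x : 'rV_n.+1, x != 0 -> 0 < dot (x *m G) x) ->
  exists2 B : 'M[R]_n.+1, B \in unitmx & G = B *m B^T.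
Proof.
move=> sG pG; have [m [l [p [sumE EE Eo AE]]]] := spectral_poly sG.
pose E i := horner_mx G (p i).
have sE i : (E i)^T = E i by exact: horner_mx_sym.
(* [Num.sqrt] is 0 on negative numbers, but a negative l_i comes with E_i = 0 because G is positive
   definite. *)
have El i : Num.sqrt (l i) ^+ 2 *: E i = l i *: E i.
  have [l0|l0] := leP 0 (l i); first by rewrite sqr_sqrtr.
  suff -> : E i = 0 by rewrite !scaler0.
  apply: mx_eq => v; rewrite mulmx0; apply/eqP/negPn/negP => v0.
  have EG : E i *m G = G *m E i by apply/esym; apply: comm_mx_horner.
  have := pG _ v0; rewrite -mulmxA EG AE -scalemxAr dotZl.
  by rewrite pmulr_lgt0 ?dot_gt0 // ltNge ltW.
pose B := \sum_i Num.sqrt (l i) *: E i.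
have sB : B^T = B by rewrite /B linear_sum; apply: eq_bigr => i _; rewrite linearZ /= sE.
have GB : G = B *m B^T.
  rewrite sB -[LHS]mulmx1 -sumE mulmx_sumr {1}/B mulmx_suml; apply: eq_bigr => i _.
  rewrite AE /B mulmx_sumr (bigD1 i) //= big1 ?addr0 => [|j ji].
    by rewrite -scalemxAl -scalemxAr scalerA -expr2 EE -/(E i) El.
  by rewrite -scalemxAl -scalemxAr Eo ?scaler0 // eq_sym.
exists B => //; rewrite -row_free_unit -kermx_eq0; apply/rowV0P => v /sub_kermxP vB.
apply/eqP/negPn/negP => /pG; rewrite GB mulmxA vB mul0mx dot0l ltxx //.
Qed.

Lemma sum3 (E : nmodType) (F : 'I_3 -> E) : \sum_i F i = F 0 + F 1 + F 2.
Proof.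
rewrite !big_ord_recl big_ord0 addr0 addrA.
by congr (F _ + F _ + F _); exact: val_inj.
Qed.

Lemma lorentz2E (R : realType) (v : 'rV[R]_3) :
  lorentz_cone v <-> 0 <= v 0 0 /\ v 0 1 ^+ 2 + v 0 2 ^+ 2 <= v 0 0 ^+ 2.
Proof.
rewrite /lorentz_cone /= !big_ord_recl big_ord0 addr0.
have -> : lift ord0 (ord0 : 'I_2) = 1 :> 'I_3 by exact: val_inj.
have -> : lift ord0 (lift ord0 (ord0 : 'I_1) : 'I_2) = 2 :> 'I_3 by exact: val_inj.
have h0 : 0 <= v 0 1 ^+ 2 + v 0 2 ^+ 2 by rewrite addr_ge0 ?sqr_ge0.
split=> [h|[h1 h2]].
  have v0 := le_trans (sqrtr_ge0 _) h; split=> //.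
  by rewrite -[leLHS]sqr_sqrtr // ler_pXn2r ?nnegrE ?sqrtr_ge0.
by rewrite -[leRHS]ger0_norm // -sqrtr_sqr ler_wsqrtr.
Qed.

(** * Stability of Lorentz factorizations *)

Section LorFactCone.
Variables (R : realType) (V1 V2 : vectType R) (C1 : set V1) (C2 : set V2).
Hypothesis cC2 : convex_cone C2.

Lemma lor_fact_gen (W : vectType R) (K : set W) (alpha : 'Hom(V1, W)) (beta : 'Hom(W, V2)) :
  lorentzian K -> pos_maps C1 K alpha -> pos_maps K C2 beta -> lor_fact C1 C2 (beta \o alpha)%VF.
Proof.
move=> lK pa pb; exists 1%N, (fun=> 1), (fun=> (beta \o alpha)%VF); split=> //.
- by rewrite big_ord1.
- by move=> _; exists W, K, alpha, beta.
- by rewrite big_ord1 scale1r.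
Qed.

(** The convex weights must still sum to 1, so t is absorbed into the second factors. *)
Lemma lor_factZ t P : 0 <= t -> lor_fact C1 C2 P -> lor_fact C1 C2 (t *: P).
Proof.
move=> t0 [m [s [a [s0 s1 aP ->]]]]; exists m, s, (fun i => t *: a i); split=> //.
  move=> i; have [W [K [al [be [lK pa pb ->]]]]] := aP i.
  exists W, K, al, (t *: be); split=> //; last by rewrite comp_lfunZl.
  move=> _ [x Kx <-]; rewrite scale_lfunE; case: cC2 => _ _; apply=> //.
  by apply: pb; exists x.
by rewrite scaler_sumr; apply: eq_bigr => i _; rewrite !scalerA mulrC.
Qed.

(** P + Q is the midpoint of 2P and 2Q. *)
Lemma lor_factD P Q : lor_fact C1 C2 P -> lor_fact C1 C2 Q -> lor_fact C1 C2 (P + Q).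
Proof.
move=> /(lor_factZ (ler0n _ 2)) [m [s [a [s0 s1 aP Pe]]]].
move=> /(lor_factZ (ler0n _ 2)) [m' [s' [a' [s0' s1' aP' Qe]]]].
exists (m + m')%N, (fun i => match split i with inl j => s j / 2 | inr j => s' j / 2 end),
  (fun i => match split i with inl j => a j | inr j => a' j end).
have half : 2^-1 * 2 = 1 :> R by rewrite mulVf ?pnatr_eq0.
split.
- by move=> i; case: split => j; rewrite mulr_ge0 // invr_ge0.
- rewrite big_split_ord /=; under eq_bigr => i _ do rewrite (unsplitK (inl _ i)).
  under [X in _ + X]eq_bigr => i _ do rewrite (unsplitK (inr _ i)).
  by rewrite -!mulr_suml s1 s1'; lra.
- by move=> i; case: split.
- rewrite big_split_ord /=; under eq_bigr => i _ do rewrite (unsplitK (inl _ i)).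
  under [X in _ = _ + X]eq_bigr => i _ do rewrite (unsplitK (inr _ i)).
  under eq_bigr => i _ do rewrite mulrC -scalerA.
  under [X in _ = _ + X]eq_bigr => i _ do rewrite mulrC -scalerA.
  by rewrite -!scaler_sumr -Pe -Qe !scalerA half !scale1r.
Qed.

Lemma lor_fact_comp (g : 'End(V2)) P : pos_maps C2 C2 g ->
  lor_fact C1 C2 P -> lor_fact C1 C2 (g \o P)%VF.
Proof.
move=> pg [m [s [a [s0 s1 aP ->]]]]; exists m, s, (fun i => (g \o a i)%VF); split=> //.
  move=> i; have [W [K [al [be [lK pa pb ->]]]]] := aP i.
  exists W, K, al, (g \o be)%VF; split=> //; last by rewrite comp_lfunA.
  by move=> _ [x Kx <-]; rewrite comp_lfunE; apply: pg; exists (be x) => //; apply: pb; exists x.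
apply/lfunP => x; rewrite comp_lfunE !sum_lfunE linear_sum; apply: eq_bigr => i _.
by rewrite !scale_lfunE comp_lfunE linearZ.
Qed.

Lemma lor_fact_pos : lor_fact C1 C2 `<=` pos_maps C1 C2.
Proof.
case: cC2 => C20 C2D C2Z _ [m [s [a [s0 s1 aP ->]]]] _ [x C1x <-]; rewrite sum_lfunE.
elim/big_rec: _ => // i y _ Cy; apply: C2D => //; rewrite scale_lfunE; apply: C2Z => //.
have [W [K [al [be [lK pa pb ->]]]]] := aP i; rewrite comp_lfunE.
by apply: pb; exists (al x) => //; apply: pa; exists x.
Qed.

End LorFactCone.

(** * The cone in orthonormal coordinates *)

Section Coordinates.
Variables (R : realType) (V : vectType R) (C : set V) (d : nat).
Variables (phi : {linear V -> 'rV[R]_d.+1}) (psi : {linear 'rV[R]_d.+1 -> V}).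
Hypotheses (phiK : cancel phi psi) (psiK : cancel psi phi).
Hypothesis cC : convex_cone C.
Hypothesis genC : generating C.
Hypothesis dualC : forall y, C y <-> forall x, C x -> 0 <= dot (phi x) (phi y).

(** Interior in metric form, for the norm of the coordinates [phi]; the comparison with [vinterior]
    is left to [symmetric_lfp]. *)
Definition core x := exists2 r, 0 < r & forall z, dot (phi z) (phi z) <= r -> C (x + z).

Hypothesis homC : forall x y, core x -> core y -> exists2 f : 'End(V), cone_iso C C f & f x = y.

Let D : set 'rV[R]_d.+1 := [set x | C (psi x)].

Lemma coord_dual y : D y <-> forall x, D x -> 0 <= dot x y.
Proof.
rewrite /D /= dualC psiK; split=> h x Dx; first by rewrite -[x]psiK; exact: h.
by apply: h; rewrite /= phiK.
Qed.

Lemma coord_basis : exists2 B : 'M[R]_d.+1, B \in unitmx & forall i, D (row i B).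
Proof.
apply: basis_from_orth => u uD; have [X CX spanX] := genC.
suff h v : dot u (phi v) = 0.
  by apply/eqP; rewrite -dot_eq0 -{2}[u]psiK h.
have vX : v \in <<in_tuple X>>%VS by rewrite /= spanX memvf.
rewrite (coord_span vX) linear_sum dotC dot_suml big1 // => i _.
rewrite linearZ /= dotZl dotC uD ?mulr0 // /D /= phiK; apply: CX.
by rewrite mem_nth.
Qed.

Lemma cone_int_core (U : set_system nat) x : free_ultra R U -> cone_int D x -> core (psi x).
Proof.
move=> fU Ox; have [r r0 rP] := cone_int_ball_sub fU coord_dual Ox.
exists r => // z zr; have [+ _] := rP (phi z) zr.
by rewrite /D /= linearD phiK.
Qed.

Lemma coord_hom (U : set_system nat) x y : free_ultra R U -> cone_int D x -> cone_int D y ->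
  exists2 g, aut D g & x *m g = y.
Proof.
move=> fU Ox Oy; have [f [[f' fK f'K] fC] fxy] := homC (cone_int_core fU Ox) (cone_int_core fU Oy).
pose g := lin1_mx (phi \o f \o psi).
have gE z : z *m g = phi (f (psi z)) by rewrite mul_rV_lin1.
have ug : g \in unitmx.
  rewrite -row_free_unit -kermx_eq0; apply/rowV0P => v /sub_kermxP.
  rewrite gE => /(congr1 psi); rewrite phiK linear0 => /(congr1 f').
  rewrite fK -[0 in RHS](linear0 f) fK => /(congr1 phi).
  by rewrite psiK linear0.
exists g; last by rewrite gE fxy psiK.
split=> // z; rewrite /D /=.
  by move=> Cz; rewrite gE phiK -fC; exists (psi z).
rewrite -[in X in X -> _]fC => -[c Cc fc].
have -> : z = phi c *m g by rewrite gE phiK fc psiK.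
by rewrite mulmxK // phiK.
Qed.

(* A linear map out of [R^3] is the triple of images of the basis, and positivity
   on the square cone says that [s + a], [s - a], [s + b], [s - b] are in [C]. *)
Definition coord_map (s a b : 'rV[R]_d.+1) : 'Hom('rV[R]_3, V) :=
  linfun (psi \o mulmxr (\matrix_(i < 3) (if i == 0 then s else if i == 1 then a else b))).

Lemma coord_mapE s a b x :
  coord_map s a b x = psi (x 0 0 *: s + x 0 1 *: a + x 0 2 *: b).
Proof. by rewrite lfunE /= mulmx_sum_row sum3 !rowK. Qed.

Lemma coord_map_ex (P : 'Hom('rV[R]_3, V)) :
  P = coord_map (phi (P (delta_mx 0 0))) (phi (P (delta_mx 0 1))) (phi (P (delta_mx 0 2))).
Proof.
apply/lfunP => x; rewrite coord_mapE {1}[x]row_sum_delta sum3.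
by rewrite !(linearD, linearZ) /= !phiK.
Qed.

(** Complete the square: the form is (y + l z)^2 + k^2 z^2 with k^2 = 1 - l^2, so [alpha] sends (x,
    y, z) to (x, y + l z, k z) and the second factor undoes this. *)
Lemma lor_fact_lorentz c u v (l : R) : -1 <= l -> l <= 1 ->
  (forall x y z : R, 0 <= x -> y ^+ 2 + 2 * l * y * z + z ^+ 2 <= x ^+ 2 ->
    D (x *: c + y *: u + z *: v)) ->
  lor_fact (@square_cone R) C (coord_map c u v).
Proof.
move=> l1 l2 h; pose k := Num.sqrt (1 - l ^+ 2).
have k2 : k ^+ 2 = 1 - l ^+ 2 by rewrite sqr_sqrtr //; nra.
pose A : 'M[R]_3 := \matrix_(i < 3) (if i == 0 then delta_mx 0 0 else
  if i == 1 then delta_mx 0 1 else l *: delta_mx 0 1 + k *: delta_mx 0 2).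
pose alpha : 'Hom('rV[R]_3, 'rV[R]_3) := linfun (mulmxr A).
have aE x : [/\ (alpha x) 0 0 = x 0 0, (alpha x) 0 1 = x 0 1 + l * x 0 2 &
    (alpha x) 0 2 = k * x 0 2].
  by rewrite lfunE /= mulmx_sum_row sum3 !rowK /= !mxE /=; split; ring.
(* For k = 0 the form is degenerate: v - l u and its negative both lie in the pointed cone D, so v =
   l u and w = 0 serves. *)
pose w := if k == 0 then 0 else k^-1 *: (v - l *: u).
have kw : k *: w = v - l *: u.
  rewrite /w; case: eqP => [k0|/eqP k0]; last by rewrite scalerA mulfV // scale1r.
  have l21 : l ^+ 2 = 1 by move: k2; rewrite k0 expr0n /= => ?; lra.
  have Dp : D (v - l *: u).
    have -> : v - l *: u = 0 *: c + (- l) *: u + 1 *: v by apply/rowP => i; rewrite !mxE; ring.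
    by apply: h => //; rewrite expr0n /= sqrrN l21; lra.
  have Dm : D (- (v - l *: u)).
    have -> : - (v - l *: u) = 0 *: c + l *: u + (- 1) *: v by apply/rowP => i; rewrite !mxE; ring.
    by apply: h => //; rewrite expr0n /= sqrrN l21 expr1n; lra.
  by rewrite scaler0 (cone_pointed coord_dual coord_basis Dp Dm).
have -> : coord_map c u v = (coord_map c u w \o alpha)%VF.
  apply/lfunP => x; rewrite comp_lfunE !coord_mapE; have [-> -> ->] := aE x.
  rewrite (mulrC k) -(scalerA _ k) kw; congr (psi _).
  by apply/rowP => i; rewrite !mxE; ring.
apply: (lor_fact_gen (K := @lorentz_cone R 2)).
- exists 2%N, \1%VF; split; first by exists id => x; rewrite id_lfunE.
  by apply/seteqP; split=> [_ [x Kx <-]|x Kx]; [rewrite id_lfunE|exists x; rewrite ?id_lfunE].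
- move=> _ [x sx <-]; apply/lorentz2E; have [-> -> ->] := aE x.
  move: sx; rewrite /square_cone /=; move: (x 0 0) (x 0 1) (x 0 2) => x0 x1 x2 sx.
  have n1 := normr_ge0 x1; have n2 := normr_ge0 x2; split; first lra.
  rewrite exprMn k2; have : (`|x1| + `|x2|) ^+ 2 <= x0 ^+ 2.
    by rewrite ler_pXn2r // nnegrE; lra.
  apply: le_trans; rewrite [leRHS]sqrrD !real_normK ?num_real //.
  have : l * (x1 * x2) <= `|x1| * `|x2|.
    apply: le_trans (ler_norm _) _; rewrite !normrM; apply: ler_piMl; first exact: mulr_ge0.
    by rewrite ler_norml l1 l2.
  by rewrite mulr2n; lra.
- move=> _ [x /lorentz2E[x0 xs] <-]; rewrite coord_mapE.
  move: x0 xs; move: (x 0 0) (x 0 1) (x 0 2) => t p q t0 pq.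
  have [k0|k0] := eqVneq k 0.
    rewrite /w k0 eqxx scaler0 addr0; have := h t p 0 t0; rewrite scale0r addr0; apply.
    by have := sqr_ge0 q; lra.
  have := h t (p - l * (q / k)) (q / k) t0.
  have -> : t *: c + (p - l * (q / k)) *: u + (q / k) *: v = t *: c + p *: u + q *: w.
    by rewrite /w (negPf k0); apply/rowP => i; rewrite !mxE; ring.
  apply; apply: le_trans pq.
  have -> : q ^+ 2 = k ^+ 2 * (q / k) ^+ 2 by rewrite -exprMn mulrCA mulfV ?mulr1.
  by rewrite k2; lra.
Qed.

Lemma coord_lfp : lorentz_factorization_property (@square_cone R) C.
Proof.
apply/seteqP; split; first exact: lor_fact_pos.
have [U fU] := exists_free_ultra R.
have dD := coord_dual; have sD := coord_basis.
have hD x y (Ox : cone_int D x) (Oy : cone_int D y) := coord_hom fU Ox Oy.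
have [e Oe ecen] := center_ex fU dD sD hD.
have [L JL] := jordan_mul_ex fU dD sD hD Oe ecen.
pose LF s a b := lor_fact (@square_cone R) C (coord_map s a b).
move=> P posP; rewrite (coord_map_ex P).
have DP x : square_cone x -> D (phi (P x)) by rewrite /D /= phiK => sx; apply: posP; exists x.
apply: (@cone_decomposition _ _ D U fU dD sD hD e Oe L JL LF).
- move=> s a b s' a' b'; rewrite /LF => h h'.
  have -> : coord_map (s + s') (a + a') (b + b') = coord_map s a b + coord_map s' a' b'.
    apply/lfunP => x; rewrite add_lfunE !coord_mapE -[RHS]linearD; congr (psi _).
    by apply/rowP => i; rewrite !mxE; ring.
  exact: lor_factD.
- move=> t s a b t0; rewrite /LF => h.
  have -> : coord_map (t *: s) (t *: a) (t *: b) = t *: coord_map s a b.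
    apply/lfunP => x; rewrite scale_lfunE !coord_mapE -[RHS]linearZ; congr (psi _).
    by apply/rowP => i; rewrite !mxE; ring.
  exact: lor_factZ.
- by move=> c u v l l1 l2 h; exact: lor_fact_lorentz h.
- move=> g s a b pg; rewrite /LF => h; pose f : 'End(V) := linfun (psi \o mulmxr g \o phi).
  have -> : coord_map (s *m g) (a *m g) (b *m g) = (f \o coord_map s a b)%VF.
    apply/lfunP => x; rewrite comp_lfunE !coord_mapE /f lfunE /= psiK; congr (psi _).
    by rewrite !mulmxDl -!scalemxAl.
  apply: lor_fact_comp => // _ [x Cx <-]; rewrite lfunE /=; apply: pg.
  by rewrite /D /= phiK.
- rewrite -!linearD; apply: DP; rewrite /square_cone /= !mxE /=.
  by rewrite !(addr0, add0r, normr0, normr1).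
- rewrite -!linearB; apply: DP; rewrite /square_cone /= !mxE /=.
  by rewrite !(addr0, add0r, subr0, sub0r, normrN, normr0, normr1).
- rewrite -!linearD; apply: DP; rewrite /square_cone /= !mxE /=.
  by rewrite !(addr0, add0r, normr0, normr1).
- rewrite -!linearB; apply: DP; rewrite /square_cone /= !mxE /=.
  by rewrite !(addr0, add0r, subr0, sub0r, normrN, normr0, normr1).
Qed.

End Coordinates.

(** * Gram matrices *)

Section InnerProduct.
Variables (R : realType) (V : vectType R) (ip : {dot V for @idfun R}).

Lemma ipC x y : ip x y = ip y x.
Proof. by rewrite hermC expr0 mul1r. Qed.

Lemma ip_gram d (v : V -> 'rV[R]_d) (r : {linear 'rV[R]_d -> V}) : cancel v r ->
  forall x y, ip x y =
    dot (v x *m \matrix_(i, j) ip (r (delta_mx 0 i)) (r (delta_mx 0 j))) (v y).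
Proof.
move=> vK x y; have rE z : z = \sum_i v z 0 i *: r (delta_mx 0 i).
  rewrite -{1}(vK z) {1}[v z]row_sum_delta linear_sum.
  by apply: eq_bigr => i _; rewrite linearZ.
rewrite {1}(rE y) linear_sumr dotE; apply: eq_bigr => j _.
rewrite linearZr_LR /= mulrC; congr (_ * _).
rewrite {1}(rE x) linear_sumlz mxE; apply: eq_bigr => i _.
by rewrite linearZl_LR /= mxE.
Qed.

End InnerProduct.

(** * From an arbitrary space to coordinates *)

Section Transport.
Variables (R : realType) (V : vectType R) (C : set V).

(** The matrix arguments run in dimension d.+1; here the zero map is factored through the half-line,
    the Lorentz cone of dimension 1. *)
Lemma dim0_lfp (v : V -> 'rV[R]_0) (r : 'rV[R]_0 -> V) : cancel v r -> convex_cone C ->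
  lorentz_factorization_property (@square_cone R) C.
Proof.
move=> vK cC; have [C_0 _ _] := cC.
have V0 x : x = 0 :> V by rewrite -(vK x) -(vK 0); rewrite [v x]thinmx0 [v 0]thinmx0.
apply/seteqP; split; first exact: lor_fact_pos.
move=> P _; have -> : P = (0 \o (0 : 'Hom('rV[R]_3, 'rV[R]_1)))%VF.
  by apply/lfunP => x; rewrite [LHS]V0 [RHS]V0.
apply: (lor_fact_gen (K := @lorentz_cone R 0)).
- exists 0%N, \1%VF; split; first by exists id => x; rewrite id_lfunE.
  by apply/seteqP; split=> [_ [x Kx <-]|x Kx]; [rewrite id_lfunE|exists x; rewrite ?id_lfunE].
- by move=> _ [x _ <-]; rewrite zero_lfunE /lorentz_cone /= big_ord0 sqrtr0 mxE.
- by move=> _ [x _ <-]; rewrite [_ x]V0.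
Qed.

(** A square root of the Gram matrix yields coordinates in which the inner product is [dot]. The
    dimension d and the isomorphisms are variables so that d can be split into 0 and a successor. *)
Lemma symmetric_lfp d (v : {linear V -> 'rV[R]_d}) (r : {linear 'rV[R]_d -> V}) :
  cancel v r -> cancel r v ->
  (forall x, interior (v @` C) (v x) -> vinterior C x) ->
  symmetric_cone C -> lorentz_factorization_property (@square_cone R) C.
Proof.
move=> vK rK vint [[cC _ _ gC] [ip Cip] homC].
case: d v r vK rK vint => [|d] v r vK rK vint; first exact: dim0_lfp vK cC.
pose G := \matrix_(i, j) ip (r (delta_mx 0 i)) (r (delta_mx 0 j)).
have ipG : forall x y, ip x y = dot (v x *m G) (v y) by exact: ip_gram.
have sG : G^T = G by apply/matrixP => i j; rewrite !mxE ipC.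
have pG (x : 'rV[R]_d.+1) : x != 0 -> 0 < dot (x *m G) x.
  move=> x0; rewrite -(rK x) -ipG; apply: neq0_dnorm_gt0.
  by apply: contra_neq x0 => rx; rewrite -(rK x) rx linear0.
have [B uB GB] := gram_sqrt sG pG.
pose phi : {linear V -> 'rV[R]_d.+1} := mulmxr B \o v.
pose psi : {linear 'rV[R]_d.+1 -> V} := r \o mulmxr (invmx B).
have phiK : cancel phi psi by move=> x; rewrite /= mulmxK.
have psiK : cancel psi phi by move=> x; rewrite /= rK mulmxKV.
have ipE x y : ip x y = dot (phi x) (phi y) by rewrite ipG GB mulmxA dot_mulr trmxK.
have dualC y : C y <-> forall x, C x -> 0 <= dot (phi x) (phi y).
  by rewrite {1}Cip /=; split=> h x Cx; have := h x Cx; rewrite ipE.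
apply: (coord_lfp phiK psiK cC gC dualC) => x y cx cy.
suff coreP z : core C phi z -> vinterior C z by apply: homC; exact: coreP.
move=> [e e0 eP]; apply: vint.
have [K K0 KP] : exists2 K, 0 < K & forall t : 'rV[R]_d.+1, dot (t *m B) (t *m B) <= K * dot t t.
  exists (1 + \sum_i \sum_j B j i ^+ 2).
    by rewrite ltr_pwDl // sumr_ge0 // => i _; rewrite sumr_ge0 // => j _; exact: sqr_ge0.
  move=> t; apply: le_trans (mulmx_norm t B) _.
  by rewrite ler_wpM2r ?dot_ge0 // lerDr.
have [N N0 NE] : exists2 N : R, 0 < N & d.+1%:R = N by exists d.+1%:R.
(* Balls are entrywise: an entry below s <= 1 has square at most s <= e/(K N), so the N squares sum
   to at most e/K. *)
pose s := Num.min 1 (e / (K * N)); have s0 : 0 < s by rewrite lt_min ltr01 divr_gt0 // mulr_gt0.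
apply/nbhs_ballP; exists s => // y' [_ By].
exists (z + r (y' - v z)); last by rewrite linearD /= rK addrC subrK.
apply: eP; rewrite /phi /= rK; apply: le_trans (KP _) _.
have ent j : (y' - v z) 0 j * (y' - v z) 0 j <= e / (K * N).
  have := By 0 j; rewrite /ball /= !mxE distrC => lt1.
  rewrite -expr2 -real_normK ?num_real //.
  have n0 := normr_ge0 (y' 0 j - v z 0 j).
  move: lt1; rewrite lt_min => /andP[lt1 lt2].
  by rewrite expr2; apply: le_trans (ltW lt2); rewrite ler_piMl // ltW.
have : dot (y' - v z) (y' - v z) <= \sum_(j < d.+1) e / (K * N).
  by rewrite dotE; apply: ler_sum => j _; exact: ent.
rewrite sumr_const card_ord -mulr_natr NE => le.
apply: (@le_trans _ _ (K * (e / (K * N) * N))); first by rewrite ler_pM2l.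
by rewrite le_eqVlt; apply/orP; left; apply/eqP; field; rewrite !gt_eqF.
Qed.

End Transport.

Theorem theorem3 (R : realType) (V : vectType R) (C : set V)
    (hC : symmetric_cone C) :
  lorentz_factorization_property (@square_cone R) C.
Proof. by apply: symmetric_lfp v2rK r2vK _ hC. Qed.
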